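(* Let $E\subset\mathbb{R}^d$ be a non-planar Galton–Watson fractal with respect to a similarity IFS $\Phi=\{\varphi_i\}_{i\in\Lambda}$ and an offspring distribution $W$. Then almost surely, conditioned on nonextinction, there exists $C>0$ such that for every hyperplane absolute winning (HAW) set $S\subset\mathbb{R}^d$, $\dim_H(E\cap S)>C$. Moreover, if in addition $\Phi$ satisfies the open set condition, then almost surely, conditioned on nonextinction, for every HAW set $S\subset\mathbb{R}^d$, $\dim_H(E\cap S)=\dim_H(E)$.
   Context: A similarity IFS is a finite family $\Phi=\{\varphi_i\}_{i\in\Lambda}$ of maps $\varphi_i:\mathbb{R}^d\to\mathbb{R}^d$, each a contracting similarity: $\|\varphi_i(x)-\varphi_i(y)\|=r_i\|x-y\|$ with $r_i\in(0,1)$. Its attractor $K$ is the unique nonempty compact set with $K=\bigcup_{i}\varphi_iK$. For a finite word $i=i_1\dots i_n\in\Lambda^*$ put $\varphi_i=\varphi_{i_1}\circ\dots\circ\varphi_{i_n}$; the coding map $\gamma_\Phi:\Lambda^{\mathbb{N}}\to\mathbb{R}^d$ sends $j$ to the unique point of $\bigcap_n\varphi_{j_1\dots j_n}(K)$. A tree with alphabet $\Lambda$ is a set $T\subseteq\Lambda^*$ (finite words, including the empty word $\emptyset$) containing $\emptyset$ and closed under taking prefixes; $T_n=T\cap\Lambda^n$ and $\partial T=\{j\in\Lambda^{\mathbb{N}}:\ j_1\dots j_n\in T_n\ \forall n\}$. Let $W$ be a random subset of $\Lambda$ with $\mathbb{P}(i\in W)>0$ for every $i\in\Lambda$ and $\mathbb{E}|W|>1$.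 The Galton–Watson tree $T$ with offspring distribution $W$ is defined by $T_0=\{\emptyset\}$, $T_n=\{aj: a\in T_{n-1},\ j\in W_a\}$, where $(W_a)_{a\in\Lambda^*}$ are independent copies of $W$; nonextinction means $T_n\neq\emptyset$ for all $n$. The Galton–Watson fractal is $E=\gamma_\Phi(\partial T)$. $E$ is non-planar if it is not almost surely contained in an affine hyperplane. $\Phi$ satisfies the open set condition if there is a nonempty open $U$ with $\varphi_iU\subseteq U$ for all $i$ and $\varphi_iU\cap\varphi_jU=\emptyset$ for $i\neq j$. Hyperplane absolute game with parameter $\beta\in(0,1/3)$: Bob chooses a closed ball $B_1$ of radius $\rho_1$; after Bob chooses $B_i$ of radius $\rho_i$, Alice chooses an affine hyperplane $\mathcal{L}_i$ and $\varepsilon_i\in(0,\beta\rho_i)$, and Bob then chooses a closed ball $B_{i+1}\subseteq B_i\setminus\mathcal{L}_i^{(\varepsilon_i)}$ of radius $\rho_{i+1}\ge\beta\rho_i$ (here $A^{(\varepsilon)}$ is the open $\varepsilon$-neighborhood). A set $S$ is HAW if for every $\beta\in(0,1/3)$ Alice has a strategy guaranteeing $\bigcap_nB_n\cap S\neq\emptyset$. *)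

(* Defs.v *)
From HB Require Import structures.
From mathcomp Require Import all_boot all_order all_algebra.
From mathcomp Require Import all_classical all_reals all_analysis.
Set Implicit Arguments. Unset Strict Implicit. Unset Printing Implicit Defensive.
Import Order.TTheory GRing.Theory Num.Theory.
Import numFieldNormedType.Exports.
Local Open Scope classical_set_scope.
Local Open Scope ring_scope.

Section Euclid.
Variables (R : realType) (d : nat).
Implicit Types (x y a : 'rV[R]_d) (A : set 'rV[R]_d).

Definition edot x y : R := \sum_(i < d) x ord0 i * y ord0 i.
Definition enorm x : R := Num.sqrt (edot x x).

Definition hyperplane (a : 'rV[R]_d) (c : R) : set 'rV[R]_d :=
  [set x | edot a x = c].

Definition eneigh A (eps : R) : set 'rV[R]_d :=
  [set x | exists2 y, A y & enorm (x - y) < eps].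

Definition cball (c : 'rV[R]_d) (r : R) : set 'rV[R]_d :=
  [set x | enorm (x - c) <= r].

(** Euclidean diameter of a set, as a real number (sup of distances;
    meaningful for bounded sets, 0 for the empty set). *)
Definition rdiam A : R := sup [set enorm (x - y) | x in A & y in A].

Definition bounded_by A (delta : R) : Prop :=
  forall x y, A x -> A y -> enorm (x - y) <= delta.

Definition hterm (s : R) A : \bar R :=
  if pselect (A = set0) then 0%E else ((rdiam A) `^ s)%:E.

Definition hausdorff_delta (s delta : R) A : \bar R :=
  ereal_inf [set (\sum_(0 <= n <oo) hterm s (F n))%E
            | F in [set F : nat -> set 'rV[R]_d |
                     A `<=` \bigcup_n F n /\ forall n, bounded_by (F n) delta]].

Definition hausdorff_measure (s : R) A : \bar R :=
  ereal_sup [set hausdorff_delta s delta A | delta in [set delta : R | 0 < delta]].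

Definition hdim A : \bar R :=
  ereal_inf [set s%:E | s in [set s : R | 0 <= s /\ hausdorff_measure s A = 0%E]].

(** Hyperplane absolute game.  A play: Bob's balls are given by centres
    [c n] and radii [rho n] (n = 0 is Bob's first ball B_1).  Alice's
    strategy maps the history of Bob's balls (the list of (centre, radius)
    of B_1, ..., B_n) to a hyperplane (normal vector a, offset c) and a
    thickness eps. *)
Definition hist := seq ('rV[R]_d * R).

Definition alice_strategy := hist -> ('rV[R]_d * R * R).

Definition play_hist (c : nat -> 'rV[R]_d) (rho : nat -> R) (n : nat) : hist :=
  mkseq (fun k => (c k, rho k)) n.+1.

Definition legal_alice_move (beta : R) (h : hist) (m : 'rV[R]_d * R * R) : Prop :=
  let: (a, cc, eps) := m in
  a != 0 /\ 0 < eps /\ eps < beta * (last (0, 0) h).2.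

Definition legal_strategy (beta : R) (sigma : alice_strategy) : Prop :=
  forall h : hist, h != [::] -> (forall k, (k < size h)%N -> 0 < (nth (0, 0) h k).2) ->
    legal_alice_move beta h (sigma h).

Definition legal_play (beta : R) (sigma : alice_strategy)
    (c : nat -> 'rV[R]_d) (rho : nat -> R) : Prop :=
  (forall n, 0 < rho n) /\
  forall n, let: (a, cc, eps) := sigma (play_hist c rho n) in
    beta * rho n <= rho n.+1 /\
    cball (c n.+1) (rho n.+1) `<=`
      cball (c n) (rho n) `\` eneigh (hyperplane a cc) eps.

Definition HAW_beta (beta : R) (S : set 'rV[R]_d) : Prop :=
  exists sigma : alice_strategy, legal_strategy beta sigma /\
    forall c rho, legal_play beta sigma c rho ->
      (\bigcap_n cball (c n) (rho n)) `&` S !=set0.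

Definition HAW (S : set 'rV[R]_d) : Prop :=
  forall beta : R, 0 < beta -> beta < 3^-1 -> HAW_beta beta S.

Definition similarity_IFS (L : finType) (phi : L -> 'rV[R]_d -> 'rV[R]_d)
    (r : L -> R) : Prop :=
  forall i, 0 < r i < 1 /\
    forall x y, enorm (phi i x - phi i y) = r i * enorm (x - y).

(** K is the attractor: nonempty compact set with K = \bigcup_i phi_i K
    (such a set exists and is unique for a contracting IFS). *)
Definition is_attractor (L : finType) (phi : L -> 'rV[R]_d -> 'rV[R]_d)
    (K : set 'rV[R]_d) : Prop :=
  K !=set0 /\ compact K /\ K = \bigcup_(i in [set: L]) (phi i @` K).

Definition phiw (L : finType) (phi : L -> 'rV[R]_d -> 'rV[R]_d) (w : seq L) :
    'rV[R]_d -> 'rV[R]_d :=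
  foldr (fun i f => phi i \o f) id w.

Definition open_set_condition (L : finType) (phi : L -> 'rV[R]_d -> 'rV[R]_d) : Prop :=
  exists U : set 'rV[R]_d, open U /\ U !=set0 /\
    (forall i, phi i @` U `<=` U) /\
    (forall i j, i != j -> phi i @` U `&` phi j @` U = set0).

End Euclid.

(** Galton-Watson trees.  [W a om] is the offspring set of the vertex a. *)
Section GW.
Variables (L : finType) (Om : Type) (W : seq L -> Om -> {set L}).

Definition in_tree (om : Om) (w : seq L) : Prop :=
  forall (u : seq L) (i : L) (v : seq L), w = u ++ i :: v -> i \in W u om.

Definition in_boundary (om : Om) (j : nat -> L) : Prop :=
  forall n, in_tree om (mkseq j n).

Definition nonextinct (om : Om) : Prop :=
  forall n, exists w, size w = n /\ in_tree om w.

End GW.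

(** The Galton-Watson fractal E = gamma_Phi(boundary of T):
    x = gamma(j) is the point of \bigcap_n phi_{j_1...j_n}(K). *)
Definition GW_fractal (R : realType) (d : nat) (L : finType) (Om : Type)
    (phi : L -> 'rV[R]_d -> 'rV[R]_d) (K : set 'rV[R]_d)
    (W : seq L -> Om -> {set L}) (om : Om) : set 'rV[R]_d :=
  [set x | exists j, in_boundary W om j /\
           forall n, (phiw phi (mkseq j n) @` K) x].

Definition iid_offspring (d0 : measure_display) (R : realType) (L : finType)
    (Om : measurableType d0) (P : probability Om R)
    (W : seq L -> Om -> {set L}) : Prop :=
  (forall a s, measurable [set om | W a om = s]) /\
  (forall a s, P [set om | W a om = s] = P [set om | W [::] om = s]) /\
  (forall (ws : seq (seq L)) (f : seq L -> {set L}), uniq ws ->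
     fine (P (\bigcap_(a in [set` ws]) [set om | W a om = f a])) =
     \prod_(a <- ws) fine (P [set om | W a om = f a])).

(* Main.v *)
(* Bob plays against a winning strategy on the fractal itself: after a vertex [w]
   of the tree he plays the ball of radius [D r_w] about [phi_w x0], and a descent
   by a block of fixed length [l] is a legal answer when the smaller ball avoids
   the neighbourhood deleted by Alice.  Every infinite play therefore ends at a
   point of [E] in the winning set, and it is enough to have a subtree of the
   Galton-Watson tree in which each vertex, whatever the hyperplane, keeps block
   descendants [b] far from it with [sum r_b^s >= 1]; a mass distribution argument
   then bounds the dimension of the surviving points from below by [s].

   Such a subtree exists with positive probability.  Since the attractor spans, a
   fixed finite tree of positive probability has branches close to [d + 1] affinely
   independent points, so some branch is far from any given hyperplane; if
   [E (sum_(i in W) r_i^s) > 1], a second moment estimate shows that below this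
   branch the descendants have large weight with a probability that does not
   depend on how unlikely it is to be the root of a good subtree, so this
   probability survives the recursion.  Independence of subtrees and the
   generating function of [|W|] put a good subtree below some vertex almost surely
   on nonextinction.  Under the open set condition [s] can be taken up to the upper
   bound for [dim E]; in general two well separated blocks give some [s > 0]. *)
Require Import Defs.
From HB Require Import structures.
From mathcomp Require Import all_boot all_order all_algebra.
From mathcomp Require Import all_classical all_reals all_analysis.
From mathcomp Require Import ring lra zify.
Set Implicit Arguments. Unset Strict Implicit. Unset Printing Implicit Defensive.
Import Order.TTheory GRing.Theory Num.Theory.
Import numFieldNormedType.Exports.
Local Open Scope classical_set_scope.
Local Open Scope ring_scope.

(** * Euclidean geometry *)

(** Two obstacles shape the argument. The exceptional null set may not depend on the winning set, of
    which there are uncountably many; so goodness of a vertex quantifies over all hyperplanes, never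
    mentions a strategy, and keeps its constants in root coordinates, where Alice's hyperplane
    arrives after pulling back by the similarity of the current vertex. The game parameter [beta] is
    then fixed last, small in terms of the block length and of the margin. The second obstacle is
    that goodness concerns infinitely many generations. It is replaced by a decreasing sequence of
    events, the [k]-th read off from finitely many levels, whose probabilities are finite sums;
    since there are finitely many words of each length, a vertex or block that works for every [k]
    can be extracted. The uniform bound [q] on these probabilities has to be fixed before the block
    length: it comes from the covering tree and the Paley-Zygmund constant alone, and only then is
    the number of rich generations chosen in terms of [q]. *)

Section Euclidean.
Variables (R : realType) (d : nat).
Implicit Types (x y z a : 'rV[R]_d).

Lemma edotC x y : edot x y = edot y x.
Proof. by apply: eq_bigr => i _; rewrite mulrC. Qed.

Lemma edotDl x y z : edot (x + y) z = edot x z + edot y z.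
Proof. by rewrite /edot -big_split; apply: eq_bigr => i _; rewrite mxE mulrDl. Qed.

Lemma edotZl c x y : edot (c *: x) y = c * edot x y.
Proof. by rewrite /edot mulr_sumr; apply: eq_bigr => i _; rewrite mxE mulrA. Qed.

Lemma edotNl x y : edot (- x) y = - edot x y.
Proof. by rewrite -scaleN1r edotZl mulN1r. Qed.

Lemma edotBl x y z : edot (x - y) z = edot x z - edot y z.
Proof. by rewrite edotDl edotNl. Qed.

Lemma edotDr x y z : edot x (y + z) = edot x y + edot x z.
Proof. by rewrite edotC edotDl !(edotC x). Qed.

Lemma edotZr c x y : edot x (c *: y) = c * edot x y.
Proof. by rewrite edotC edotZl edotC. Qed.

Lemma edotBr x y z : edot x (y - z) = edot x y - edot x z.
Proof. by rewrite edotC edotBl !(edotC x). Qed.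

Lemma edot_mulmx x y : edot x y = (x *m y^T) ord0 ord0.
Proof. by rewrite mxE; apply: eq_bigr => i _; rewrite mxE. Qed.

Lemma edot_ge0 x : 0 <= edot x x.
Proof. by apply: sumr_ge0 => i _; rewrite -expr2 sqr_ge0. Qed.

Lemma edot_eq0 x : (edot x x == 0) = (x == 0).
Proof.
apply/idP/eqP => [|->]; last by rewrite /edot big1// => i _; rewrite mxE mul0r.
rewrite psumr_eq0 => [/allP x0|i _]; last by rewrite -expr2 sqr_ge0.
apply/rowP => i; have := x0 i (mem_index_enum i).
by rewrite mxE /= mulf_eq0 orbb => /eqP.
Qed.

Lemma enorm_ge0 x : 0 <= enorm x. Proof. exact: sqrtr_ge0. Qed.

Lemma sqr_enorm x : enorm x ^+ 2 = edot x x.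
Proof. by rewrite sqr_sqrtr ?edot_ge0. Qed.

Lemma enorm_eq0 x : (enorm x == 0) = (x == 0).
Proof. by rewrite -edot_eq0 -sqr_enorm sqrf_eq0. Qed.

Lemma enorm0 : enorm (0 : 'rV[R]_d) = 0.
Proof. by apply/eqP; rewrite enorm_eq0. Qed.

Lemma enorm_gt0 x : (0 < enorm x) = (x != 0).
Proof. by rewrite lt_def enorm_eq0 enorm_ge0 andbT. Qed.

Lemma enormZ c x : enorm (c *: x) = `|c| * enorm x.
Proof.
apply/eqP; rewrite -(eqrXn2 (n := 2))// ?mulr_ge0 ?enorm_ge0//.
by rewrite exprMn !sqr_enorm edotZl edotZr mulrA real_normK ?num_real// expr2.
Qed.

Lemma enormN x : enorm (- x) = enorm x.
Proof. by rewrite -scaleN1r enormZ normrN1 mul1r. Qed.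

Lemma enormC x y : enorm (x - y) = enorm (y - x).
Proof. by rewrite -enormN opprB. Qed.

Lemma cauchy_schwarz x y : `|edot x y| <= enorm x * enorm y.
Proof.
rewrite -(@ler_pXn2r _ 2)// ?nnegrE ?mulr_ge0 ?enorm_ge0//.
rewrite exprMn real_normK ?num_real// !sqr_enorm.
have [/eqP|y0] := eqVneq (edot y y) 0.
  by rewrite edot_eq0 => /eqP ->; rewrite -(scale0r 0) !edotZr !mul0r expr0n mulr0.
have := edot_ge0 (edot y y *: x - edot x y *: y).
rewrite !edotBl !edotBr !edotZl !edotZr (edotC y x).
have yp : 0 < edot y y by rewrite lt_def y0 edot_ge0.
set A := edot x x; set B := edot y y in yp *; set C := edot x y.
rewrite (_ : _ - _ = B * (A * B - C ^+ 2)); last by ring.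
by rewrite pmulr_rge0// subr_ge0.
Qed.

Lemma enormD x y : enorm (x + y) <= enorm x + enorm y.
Proof.
rewrite -(@ler_pXn2r _ 2)// ?nnegrE ?addr_ge0 ?enorm_ge0//.
rewrite sqr_enorm edotDl !edotDr sqrrD !sqr_enorm (edotC y x).
have := le_trans (ler_norm _) (cauchy_schwarz x y).
by set u := enorm x * _; rewrite mulr2n; lra.
Qed.

Lemma enorm_triangle z x y : enorm (x - y) <= enorm (x - z) + enorm (z - y).
Proof. by rewrite -(subrKA z) enormD. Qed.

Lemma coord_le_enorm x i : `|x ord0 i| <= enorm x.
Proof.
rewrite -(@ler_pXn2r _ 2)// ?nnegrE ?enorm_ge0// real_normK ?num_real//.
rewrite sqr_enorm /edot (bigD1 i)//= -expr2 lerDl.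
by apply: sumr_ge0 => j _; rewrite -expr2 sqr_ge0.
Qed.

Lemma enorm_le_sum x : enorm x <= \sum_i `|x ord0 i|.
Proof.
rewrite -(@ler_pXn2r _ 2)// ?nnegrE ?enorm_ge0 ?sumr_ge0// sqr_enorm.
rewrite /edot expr2 mulr_sumr; apply: ler_sum => i _.
rewrite -expr2 -real_normK ?num_real// expr2 ler_wpM2r//.
by rewrite (bigD1 i)//= lerDl sumr_ge0.
Qed.

End Euclidean.

Lemma enorm_mulmx_le (R : realType) d (N : 'M[R]_d) :
  exists2 C : R, 0 < C & forall x : 'rV_d, enorm (x *m N) <= C * \sum_i `|x ord0 i|.
Proof.
exists (1 + \sum_i \sum_j `|N i j|) => [|x].
  by apply: ltr_wpDr => //; apply: sumr_ge0 => i _; apply: sumr_ge0.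
apply: le_trans (enorm_le_sum _) _.
apply: (@le_trans _ _ (\sum_j \sum_i `|x ord0 i| * `|N i j|)).
  apply: ler_sum => j _; rewrite mxE; apply: le_trans (ler_norm_sum _ _ _) _.
  by apply: ler_sum => i _; rewrite normrM.
rewrite exchange_big mulr_sumr; apply: ler_sum => i _ /=.
rewrite -mulr_sumr mulrC ler_wpM2r//.
rewrite [X in 1 + X](bigD1 i)//= addrCA lerDl addr_ge0//.
by apply: sumr_ge0 => k _; apply: sumr_ge0.
Qed.

Section Similarity.
Variables (R : realType) (d : nat).
Implicit Types (x y z a : 'rV[R]_d).

(* The images of the standard basis under the normalized map are the rows of
   an orthogonal matrix [O], and [f x = (f x *m O^T) *m O] where the entries of
   [f x *m O^T] are the inner products [edot (f x) (f e_i) = x_i]. *)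
Lemma similarity_affine (f : 'rV[R]_d -> 'rV[R]_d) (r : R) :
  0 < r -> (forall x y, enorm (f x - f y) = r * enorm (x - y)) ->
  exists (M : 'M[R]_d) b, M \in unitmx /\ forall x, f x = x *m M + b.
Proof.
move=> r0 fr; pose g x := r^-1 *: (f x - f 0).
have gE x y : enorm (g x - g y) = enorm (x - y).
  rewrite /g -scalerBr enormZ ger0_norm ?invr_ge0 ?ltW//.
  by rewrite (_ : _ - _ = f x - f y) ?fr ?mulrA ?mulVf ?gt_eqF ?mul1r//; rewrite opprB subrKA.
have g0 : g 0 = 0 by rewrite /g subrr scaler0.
have gn x : edot (g x) (g x) = edot x x.
  by have := gE x 0; rewrite g0 !subr0 -!sqr_enorm => ->.
have gd x y : edot (g x) (g y) = edot x y.
  have : edot (g x - g y) (g x - g y) = edot (x - y) (x - y) by rewrite -!sqr_enorm gE.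
  by rewrite !edotBl !edotBr !gn (edotC (g y)) (edotC y); lra.
pose O := \matrix_(i < d) g (delta_mx 0 i).
have OOT : O *m O^T = 1%:M.
  apply/matrixP => i j; rewrite -[LHS]/((O *m O^T) i j).
  have -> : (O *m O^T) i j = edot (g (delta_mx 0 i)) (g (delta_mx 0 j)).
    by rewrite mxE; apply: eq_bigr => k _; rewrite !mxE.
  by rewrite gd edot_mulmx trmx_delta mul_delta_mx_cond mulmxnE !mxE !eqxx.
have OU : O \in unitmx by case/mulmx1_unit: OOT.
exists (r *: O), (f 0); split; first by rewrite unitmxZ// unitfE gt_eqF.
move=> x; have gxO : g x = x *m O.
  rewrite -[LHS]mulmx1 -(mulmx1C OOT) mulmxA; congr (_ *m _).
  apply/rowP => i; transitivity (edot (g x) (g (delta_mx 0 i))).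
    by rewrite mxE; apply: eq_bigr => k _; rewrite !mxE.
  by rewrite gd edot_mulmx trmx_delta -colE mxE.
by rewrite -scalemxAr -gxO scalerA divff ?gt_eqF// scale1r subrK.
Qed.

Lemma similarity_surj (f : 'rV[R]_d -> 'rV[R]_d) (r : R) :
  0 < r -> (forall x y, enorm (f x - f y) = r * enorm (x - y)) ->
  forall y, exists x, f x = y.
Proof.
move=> r0 /(similarity_affine r0)[M [b [MU fE]]] y.
by exists ((y - b) *m invmx M); rewrite fE mulmxKV// subrK.
Qed.

(** Lets Alice's hyperplane, chosen at the scale of a vertex, be pulled back to the scale of the
    root. *)
Lemma similarity_hyperplane (f : 'rV[R]_d -> 'rV[R]_d) (r : R) a c :
  0 < r -> (forall x y, enorm (f x - f y) = r * enorm (x - y)) -> a != 0 ->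
  exists a' c', a' != 0 /\ forall x, hyperplane a c (f x) <-> hyperplane a' c' x.
Proof.
move=> r0 /(similarity_affine r0)[M [b [MU fE]]] a0.
exists (a *m M^T), (c - edot a b); split.
  apply: contraNneq a0 => aM; rewrite -[a](mulmxK (_ : M^T \in unitmx)) ?unitmx_tr//.
  by rewrite aM mul0mx.
move=> x; rewrite /hyperplane /= fE edotDr.
have -> : edot (a *m M^T) x = edot a (x *m M) by rewrite !edot_mulmx trmx_mul mulmxA.
by split=> [<-|->]; rewrite ?addrK ?subrK.
Qed.

Lemma compact_enorm_bounded (K : set 'rV[R]_d) : compact K ->
  exists2 C : R, 0 < C & forall x, K x -> enorm x <= C.
Proof.
move=> /compact_bounded[M [_ /(_ (M + 1))]]; rewrite ltrDl ltr01 => /(_ isT) MK.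
exists (1 + d%:R * `|M + 1|) => [|x Kx]; first by rewrite ltr_pwDl ?mulr_ge0.
apply: le_trans (enorm_le_sum _) _; apply: le_trans (_ : \sum_(i < d) `|M + 1| <= _); last first.
  by rewrite sumr_const card_ord mulr_natl lerDr.
apply: ler_sum => i _; apply: le_trans (ler_norm _).
apply: le_trans (MK x Kx); rewrite /Num.norm /= mx_normrE.
exact: (le_bigmax _ (fun ij => `|x ij.1 ij.2|) (ord0, i)).
Qed.

(** The topology on row vectors is that of the sup norm, which the Euclidean norm dominates
    coordinatewise. *)
Lemma closed_enorm (K : set 'rV[R]_d) x : closed K ->
  (forall e, 0 < e -> exists2 y, K y & enorm (x - y) < e) -> K x.
Proof.
move=> Kc xK; apply: Kc => B /nbhs_ballP[e /= e0 eB].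
have [y Ky xy] := xK _ e0; exists y; split=> //; apply: eB.
split=> // i j; rewrite (ord1 i).
by apply: le_lt_trans xy; have := coord_le_enorm (x - y) j; rewrite !mxE.
Qed.

End Similarity.

(** * Quantitative affine independence and packing *)

Section HyperplaneGeometry.
Variables (R : realType) (d : nat).
Implicit Types (x y z a : 'rV[R]_d).

Lemma hyperplane_dist a c y z : hyperplane a c y ->
  `|edot a z - c| <= enorm a * enorm (z - y).
Proof. by move=> <-; rewrite -edotBr; exact: cauchy_schwarz. Qed.

(** Points are chosen greedily, each off a hyperplane through the previous ones and from its own
    prescribed set. The differences then form an invertible matrix [M], and a vector [a] almost
    orthogonal to all its rows would, after inverting, be shorter than itself. *)
Lemma spanning_points (A : nat -> set 'rV[R]_d) : (0 < d)%N ->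
  (forall k a c, a != 0 -> exists2 y, A k y & ~ hyperplane a c y) ->
  exists (y : nat -> 'rV[R]_d) (eta : R), [/\ forall k, A k (y k), 0 < eta &
    forall a c, a != 0 -> exists2 k, (k <= d)%N & eta * enorm a <= `|edot a (y k) - c| ].
Proof.
move=> d0 AH.
have a1 : (const_mx 1 : 'rV[R]_d) != 0.
  by apply/eqP => /rowP/(_ (Ordinal d0)); rewrite !mxE; apply/eqP; rewrite oner_eq0.
pose V (y : nat -> 'rV[R]_d) k : 'M[R]_d := (\sum_(i < k) <<y i.+1 - y 0%N>>)%MS.
have [y [Ay ry]] : exists y : nat -> 'rV_d, (forall k, A k (y k)) /\ (d <= \rank (V y d))%N.
  suff H k : (k <= d)%N -> exists y : nat -> 'rV_d, (forall k, A k (y k)) /\ (k <= \rank (V y k))%N.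
    exact: H.
  elim: k => [_|k IH kd].
    have /choice[y Ay] k : exists y, A k y by have [y Ay _] := AH k _ 0 a1; exists y.
    by exists y; split.
  have [y [Ay ry]] := IH (ltnW kd).
  have Vle (w : nat -> 'rV_d) : (V w k <= V w k.+1)%MS by rewrite /V big_ord_recr /= addsmxSl.
  have [rk|rk] := ltnP k (\rank (V y k)).
    by exists y; split=> //; apply: leq_trans rk (mxrankS (Vle y)).
  (* [a] is a normal to the differences found so far, available because their rank is below [d]; a
     point off the hyperplane through [y 0] with this normal raises the rank. *)
  have /rowV0Pn[a aV a0] : kermx (V y k)^T != 0.
    rewrite -mxrank_eq0 mxrank_ker mxrank_tr -lt0n subn_gt0.
    exact: leq_ltn_trans rk kd.
  have [w Aw aw] := AH k.+1 a (edot a (y 0%N)) a0.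
  pose y' i := if i == k.+1 then w else y i.
  have VE : V y' k = V y k.
    by apply: eq_bigr => i _; rewrite /y' /= eqSS ltn_eqF.
  exists y'; split; first by move=> i; rewrite /y'; case: eqVneq => // ->.
  apply: (leq_ltn_trans ry); rewrite -VE; apply: rank_ltmx.
  rewrite ltmxE Vle /V big_ord_recr /= addsmx_sub submx_refl /= genmxE -/(V y' k) VE.
  rewrite /y' eqxx /=; apply/negP => /submxP[D wE]; apply: aw.
  rewrite /hyperplane /=; apply/eqP; rewrite -subr_eq0 -edotBr wE edot_mulmx trmx_mul mulmxA.
  by move/sub_kermxP: aV => ->; rewrite mul0mx mxE.
pose M := \matrix_(i < d) (y i.+1 - y 0%N).
have MU : M^T \in unitmx.
  rewrite unitmx_tr -row_full_unit /row_full eqn_leq rank_leq_row (leq_trans ry)//.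
  apply: mxrankS; apply/sumsmx_subP => i _; rewrite genmxE.
  by rewrite (_ : _ - _ = row i M) ?row_sub// rowK.
have [C C0 CM] := enorm_mulmx_le (invmx M^T).
(* Chosen so that [2 * C * d * eta < 1]. *)
pose eta := (2 * C * d%:R + 1)^-1.
have den0 : 0 < 2 * C * d%:R + 1.
  by rewrite ltr_wpDl// !mulr_ge0// ltW.
have eta0 : 0 < eta by rewrite invr_gt0.
exists y, eta; split=> // a c a0; apply: contrapT => H.
have an : 0 < enorm a by rewrite enorm_gt0.
have Hk k : (k <= d)%N -> `|edot a (y k) - c| < eta * enorm a.
  by move=> kd; rewrite ltNge; apply/negP => Hk; apply: H; exists k.
have : enorm a <= C * \sum_(i < d) (2 * eta * enorm a).
  rewrite -{1}[a](mulmxK MU); apply: le_trans (CM _) _; rewrite ler_pM2l//.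
  apply: ler_sum => i _.
  have -> : (a *m M^T) ord0 i = (edot a (y i.+1) - c) - (edot a (y 0%N) - c).
    by rewrite opprB addrA subrK -edotBr mxE; apply: eq_bigr => k _; rewrite !mxE.
  apply: le_trans (ler_normB _ _) _.
  by have := Hk _ (ltn_ord i); have := Hk 0%N isT; lra.
rewrite sumr_const card_ord -mulr_natl; apply/negP; rewrite -ltNge.
rewrite (_ : _ * _ = (2 * C * d%:R * eta) * enorm a); last by ring.
rewrite gtr_pMl// /eta ltr_pdivrMr// mul1r; lra.
Qed.

(** The points lie in a cube cut into cells of side [alpha * delta / d.+1]. Two points in one cell
    are closer than [alpha * delta], and the number of cells does not depend on [delta]. *)
Lemma packing (C alpha : R) : 0 < alpha -> 0 <= C ->
  exists N, forall (I : eqType) (ps : seq I) (f : I -> 'rV[R]_d) z delta, 0 < delta ->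
    uniq ps -> {in ps, forall p, enorm (f p - z) <= C * delta} ->
    {in ps &, forall p q, p != q -> alpha * delta <= enorm (f p - f q)} ->
    (size ps <= N)%N.
Proof.
move=> al0 C0; pose T := 2 * C * d.+1%:R / alpha; pose m := (Num.truncn T).
have T0 : 0 <= T by rewrite divr_ge0 ?mulr_ge0// ltW.
exists #|{ffun 'I_d -> 'I_m.+1}| => I ps f z delta de0 ups fz fs.
pose s := alpha * delta / d.+1%:R.
have s0 : 0 < s by rewrite divr_gt0 ?mulr_gt0.
pose v p i := ((f p - z) ord0 i + C * delta) / s.
have v0 p i : p \in ps -> 0 <= v p i <= T.
  move=> pps; have := le_trans (coord_le_enorm _ i) (fz p pps); rewrite ler_norml => /andP[h1 h2].
  rewrite /v divr_ge0 ?(ltW s0)//=; last by rewrite -lerBlDr sub0r.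
  rewrite ler_pdivrMr//; have -> : T * s = 2 * C * delta.
    by rewrite /T /s; field; rewrite gt_eqF//= gt_eqF// ltr0n.
  by lra.
pose g p := [ffun i : 'I_d => inord (Num.truncn (v p i)) : 'I_m.+1].
have gi : {in ps &, injective g}.
  move=> p q pps qps gpq; apply/eqP; apply: contraT => pq.
  have := fs _ _ pps qps pq; rewrite leNgt => /negP[].
  apply: le_lt_trans (enorm_le_sum _) _.
  apply: (@le_lt_trans _ _ (\sum_(i < d) s)); last first.
    rewrite sumr_const card_ord (_ : alpha * delta = d.+1%:R * s).
      by rewrite mulr_natl ltr_pMn2l.
    by rewrite /s; field; rewrite gt_eqF// ltr0n.
  apply: ler_sum => i _.
  have /ffunP/(_ i) := gpq; rewrite !ffunE => /(congr1 val) /=.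
  have /andP[vp0 vpT] := v0 p i pps; have /andP[vq0 vqT] := v0 q i qps.
  rewrite !inordK ?ltnS ?le_truncn// => tpq.
  have /andP[p1 p2] := truncn_itv vp0; have /andP[q1 q2] := truncn_itv vq0.
  rewrite tpq in p1 p2.
  have -> : (f p - f q) ord0 i = (v p i - v q i) * s.
    by rewrite /v -mulrBl mulfVK ?gt_eqF// !mxE; lra.
  rewrite normrM (gtr0_norm s0) ger_pMl// ler_norml.
  by rewrite -natr1 in p2 q2; apply/andP; split; lra.
have := max_card [in map g ps]; rewrite (card_uniqP _) ?size_map//.
by rewrite map_inj_in_uniq.
Qed.

End HyperplaneGeometry.

(** * Galton-Watson trees of finite depth *)

Section LabelledTrees.
Variable L : finType.

(** Every word carries an offspring set, also outside the tree, so that a realisation [W^~ om] is a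
    labelling and subtrees are plain shifts. *)
Definition lab := seq L -> {set L}.
Definition shift (w : seq L) (t : lab) : lab := fun u => t (w ++ u).

Fixpoint intree (t : lab) (w : seq L) : bool :=
  if w is i :: w' then (i \in t [::]) && intree (shift [:: i] t) w' else true.

Implicit Types (t : lab) (Q : set lab).

Lemma shift_cat u v t : shift (u ++ v) t = shift v (shift u t).
Proof. by rewrite /shift; apply/funext => w; rewrite catA. Qed.

Lemma intree_cat t u v : intree t (u ++ v) = intree t u && intree (shift u t) v.
Proof.
elim: u t => [|i u IH] t //=; rewrite -andbA; congr andb.
by rewrite IH -shift_cat.
Qed.

Lemma in_treeP (Om : Type) (W : seq L -> Om -> {set L}) om w :
  in_tree W om w <-> intree (W^~ om) w.
Proof.
split.
  elim/last_ind: w => [|w i IH] // H; rewrite -cats1 intree_cat; apply/andP; split.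
    by apply: IH => u j v e; apply: (H u j (rcons v i)); rewrite e rcons_cat.
  by rewrite /= andbT /shift cats0; apply: (H w i [::]); rewrite cats1.
by move=> + u i v e; rewrite e intree_cat /= /shift cats0 => /andP[_ /andP[]].
Qed.

Definition all_at n (Q : set lab) : set lab :=
  [set t | forall w, size w = n -> intree t w -> Q (shift w t)].

Definition covers n (t0 : lab) (Q : set lab) : set lab :=
  [set t | forall w, size w = n -> intree t0 w -> intree t w /\ Q (shift w t)].

Lemma all_atS n Q t : all_at n.+1 Q t <->
  forall i, i \in t [::] -> all_at n Q (shift [:: i] t).
Proof.
split=> [H i it w wn iw|H [//|i w] /= [wn] /andP[it iw]].
  by rewrite -shift_cat; apply: H => //=; rewrite ?wn// it.
by have := H i it w wn iw; rewrite -shift_cat.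
Qed.

Lemma coversS n t0 Q t : t [::] = t0 [::] ->
  (forall i, i \in t0 [::] -> covers n (shift [:: i] t0) Q (shift [:: i] t)) ->
  covers n.+1 t0 Q t.
Proof.
move=> e H [//|i w] /= [wn] /andP[it iw]; rewrite e it /=.
by have := H i it w wn iw; rewrite -shift_cat.
Qed.

(** Truncations to depth [n] form a finite type, which turns expectations into finite sums; the
    function component holds the subtrees of all children, kept or not. *)
Fixpoint conf (n : nat) : finType :=
  if n is n'.+1 then ({set L} * {ffun L -> conf n'})%type else unit.

(* Vertices of length at least [n] carry the empty offspring set. *)
Fixpoint emb n : conf n -> lab :=
  if n is n'.+1 return conf n -> lab then
    fun c w => if w is i :: w' then emb (c.2 i) w' else c.1
  else fun _ _ => finset.set0.

End LabelledTrees.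

(** * Expectations over truncated trees *)

Section FiniteExpectation.
Variables (R : realType) (L : finType) (p : {set L} -> R).
Hypotheses (p_ge0 : forall s, 0 <= p s) (p_sum1 : \sum_s p s = 1).
Implicit Types (n N : nat) (Q : set (lab L)) (F : lab L -> R).

Fixpoint pw n : conf L n -> R :=
  if n is n'.+1 return conf L n -> R then
    fun c => p c.1 * \prod_i pw (c.2 i)
  else fun _ => 1.

Definition Ex n F : R := \sum_(c : conf L n) pw c * F (emb c).
(** Conditional expectation given that the root keeps [s]: the factor [p s] is left out. *)
Definition Exr n (s : {set L}) F : R :=
  \sum_(f : {ffun L -> conf L n}) (\prod_i pw (f i)) * F (@emb L n.+1 (s, f)).
Definition ind Q : lab L -> R := fun t => (`[< Q t >])%:R.
Definition Pr n Q := Ex n (ind Q).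

Lemma pw_ge0 n (c : conf L n) : 0 <= pw c.
Proof. by elim: n c => //= n IH c; rewrite mulr_ge0 ?prodr_ge0. Qed.

Lemma ExS n F : Ex n.+1 F = \sum_s p s * Exr n s F.
Proof.
rewrite /Ex /Exr; under [RHS]eq_bigr do rewrite mulr_sumr.
by rewrite pair_bigA; apply: eq_bigr => -[s f] _ /=; rewrite mulrA.
Qed.

(** Independence of the subtrees at distinct children, by distributing the product over the sums. *)
Lemma Exr_prod n s F (G : L -> lab L -> R) :
  (forall t, t [::] = s -> F t = \prod_i G i (shift [:: i] t)) ->
  Exr n s F = \prod_i Ex n (G i).
Proof.
move=> FG; rewrite /Ex bigA_distr_bigA; apply: eq_bigr => f _ /=.
by rewrite big_split FG.
Qed.

Lemma sum_pw n : \sum_(c : conf L n) pw c = 1.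
Proof.
elim: n => [|n IH]; first by rewrite (bigD1 tt)//= big1 ?addr0// => -[].
have -> : \sum_(c : conf L n.+1) pw c = Ex n.+1 (fun=> 1).
  by apply: eq_bigr => c _; rewrite mulr1.
rewrite ExS -[RHS]p_sum1; apply: eq_bigr => s _.
rewrite (@Exr_prod _ _ _ (fun _ _ => 1)) => [|t _]; last by rewrite big1.
rewrite big1 ?mulr1// => i _; rewrite -[RHS]IH.
by apply: eq_bigr => c _; rewrite mulr1.
Qed.

Lemma Ex_cst n k : Ex n (fun=> k) = k.
Proof. by rewrite /Ex -mulr_suml sum_pw mul1r. Qed.

Lemma Ex_le n F G : (forall t, F t <= G t) -> Ex n F <= Ex n G.
Proof. by move=> FG; apply: ler_sum => c _; rewrite ler_wpM2l ?pw_ge0. Qed.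

Lemma eq_Ex n F G : (forall t, F t = G t) -> Ex n F = Ex n G.
Proof. by move=> FG; apply: eq_bigr => c _; rewrite FG. Qed.

Lemma Exr_le n s F G : (forall t, t [::] = s -> F t <= G t) -> Exr n s F <= Exr n s G.
Proof.
by move=> FG; apply: ler_sum => c _; rewrite ler_wpM2l ?FG ?prodr_ge0// => i _; rewrite pw_ge0.
Qed.

Lemma eq_Exr n s F G : (forall t, t [::] = s -> F t = G t) -> Exr n s F = Exr n s G.
Proof. by move=> FG; apply: eq_bigr => c _; rewrite FG. Qed.

Lemma ExD n F G : Ex n (fun t => F t + G t) = Ex n F + Ex n G.
Proof. by rewrite /Ex -big_split; apply: eq_bigr => c _; rewrite mulrDr. Qed.

Lemma ExZ n k F : Ex n (fun t => k * F t) = k * Ex n F.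
Proof. by rewrite /Ex mulr_sumr; apply: eq_bigr => c _; rewrite mulrCA. Qed.

Lemma Exr_sum n s (I : Type) (r : seq I) (P : pred I) (F : I -> lab L -> R) :
  Exr n s (fun t => \sum_(i <- r | P i) F i t) = \sum_(i <- r | P i) Exr n s (F i).
Proof.
rewrite /Exr exchange_big; apply: eq_bigr => c _ /=.
by rewrite mulr_sumr.
Qed.

Lemma ExrZ n s k F : Exr n s (fun t => k * F t) = k * Exr n s F.
Proof. by rewrite /Exr mulr_sumr; apply: eq_bigr => c _; rewrite mulrCA. Qed.

Lemma Ex_ge0 n F : (forall t, 0 <= F t) -> 0 <= Ex n F.
Proof. by move=> F0; rewrite -(Ex_cst n 0) Ex_le. Qed.

Lemma ind_ge0 Q t : 0 <= ind Q t. Proof. exact: ler0n. Qed.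
Lemma ind_le1 Q t : ind Q t <= 1. Proof. by rewrite /ind lern1 leq_b1. Qed.

Lemma le_ind (Q Q' : set (lab L)) t t' : (Q t -> Q' t') -> ind Q t <= ind Q' t'.
Proof.
rewrite /ind => QQ; case: asboolP => // Qt.
by rewrite (asboolT (QQ Qt)).
Qed.

Lemma Pr_le n (Q Q' : set (lab L)) : Q `<=` Q' -> Pr n Q <= Pr n Q'.
Proof. by move=> QQ; apply: Ex_le => t; apply: le_ind; exact: QQ. Qed.

Lemma Pr_ge0 n Q : 0 <= Pr n Q. Proof. exact/Ex_ge0/ind_ge0. Qed.
Lemma Pr_le1 n Q : Pr n Q <= 1.
Proof. by rewrite -[leRHS](Ex_cst n) Ex_le// => t; rewrite ind_le1. Qed.

Lemma PrC n Q : Pr n (~` Q) = 1 - Pr n Q.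
Proof.
apply/eqP; rewrite eq_sym subr_eq -ExD -[X in X == _](Ex_cst n); apply/eqP/eq_Ex => t.
rewrite /ind /setC /=; case: (asboolP (Q t)) => Qt.
  by rewrite (asboolF (_ : ~ ~ Q t)) ?add0r//; exact/contrapT.
by rewrite (asboolT Qt) addr0.
Qed.

Lemma PrS_ge n s F Q (G : L -> lab L -> R) :
  (forall t, t [::] = s -> \prod_i G i (shift [:: i] t) <= ind Q t) ->
  p s * \prod_i Ex n (G i) <= Pr n.+1 Q.
Proof.
move=> GQ; rewrite /Pr ExS (bigD1 s)//=.
rewrite -(@Exr_prod n s (fun t => \prod_i G i (shift [:: i] t)) G)//.
apply: ler_wpDr; last by rewrite ler_wpM2l ?Exr_le.
apply: sumr_ge0 => s' _; rewrite mulr_ge0//.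
have <- : Exr n s' (fun=> 0) = 0 by rewrite /Exr big1// => f _; rewrite mulr0.
by apply: Exr_le => t _; exact: ind_ge0.
Qed.

(** By independence the bounds multiply over the finitely many vertices of [t0] at level [n]. What
    matters is that [k] is fixed before [N] and [Q]: it survives the recursion on the depth of
    goodness. *)
Lemma Pr_covers n : forall t0, (forall u, 0 < p (t0 u)) -> forall c, 0 < c ->
  exists2 k, 0 < k & forall N Q, c <= Pr N Q -> k <= Pr (n + N) (covers n t0 Q).
Proof.
elim: n => [|n IH] t0 pt0 c c0.
  exists c => // N Q /le_trans; apply; apply: Pr_le => t Qt [|//] _ _.
  by split.
have /choice[k kP] i : exists k, 0 < k /\
    forall N Q, c <= Pr N Q -> k <= Pr (n + N) (covers n (shift [:: i] t0) Q).
  have [k k0 H] := IH (shift [:: i] t0) (fun u => pt0 _) c c0.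
  by exists k.
exists (p (t0 [::]) * \prod_(i in t0 [::]) k i).
  by rewrite mulr_gt0// prodr_gt0// => i _; case: (kP i).
move=> N Q cQ.
pose G i := if i \in t0 [::] then ind (covers n (shift [:: i] t0) Q) else fun=> 1.
apply: (@le_trans _ _ (p (t0 [::]) * \prod_i Ex (n + N) (G i))).
  rewrite ler_wpM2l// big_mkcond /=; apply: ler_prod => i _; rewrite /G.
  case: ifP => it; last by rewrite Ex_cst ler01 lexx.
  by have [k0 H] := kP i; rewrite (ltW k0) H.
apply: PrS_ge => // t tt0; rewrite /ind.
case: asboolP => [_|H].
  apply: (@le_trans _ _ (\prod_(i : L) (1 : R))); last by rewrite big1.
  by apply: ler_prod => i _; rewrite /G; case: ifP => _; rewrite ?ind_ge0 ?ind_le1 ?ler01 ?lexx.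
have [i it Hi] : exists2 i, i \in t0 [::] & ~ covers n (shift [:: i] t0) Q (shift [:: i] t).
  apply: contrapT => Hn; apply: H; apply: coversS => // i it.
  by apply: contrapT => ?; apply: Hn; exists i.
by rewrite (bigD1 i)//= /G it /ind asboolF// mul0r.
Qed.

Definition pgf (x : R) := \sum_s p s * x ^+ #|s|.

(** Given the root set, the subtrees are independent, so each generation applies the generating
    function once. *)
Lemma Pr_all_at n N Q : Pr (n + N) (all_at n Q) = iter n pgf (Pr N Q).
Proof.
elim: n => [|n IH] /=.
  apply: eq_Ex => t; rewrite /ind; congr (nat_of_bool _)%:R; apply/asbool_equiv_eq.
  by split=> [/(_ [::] erefl isT)//|Qt [|//]].
rewrite -IH /Pr addSn ExS; apply: eq_bigr => s _; congr (_ * _).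
rewrite (@Exr_prod _ _ _ (fun i => if i \in s then ind (all_at n Q) else fun=> 1)).
  under eq_bigr do rewrite (fun_if (Ex _)) Ex_cst.
  by rewrite -big_mkcond /= prodr_const.
move=> t ts; rewrite /ind; case: asboolP => [/all_atS H|H].
  rewrite big1// => i _; case: ifP => // i_s.
  by rewrite asboolT//; apply: H; rewrite ts.
have [i it Hi] : exists2 i, i \in t [::] & ~ all_at n Q (shift [:: i] t).
  apply: contrapT => Hn; apply: H; apply/all_atS => i it.
  by apply: contrapT => ?; apply: Hn; exists i.
by rewrite (bigD1 i)//= -ts it asboolF// mul0r.
Qed.

(** * Moments of weighted level sums *)

Section Moments.
Variable w : L -> R.
Hypothesis w01 : forall i, 0 <= w i <= 1.

(** Recursive form of a sum over the vertices of level [n], each weighted by the product of [w]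
    along its word; [wsum_level] unfolds it. *)
Fixpoint wsum (H : lab L -> R) n (t : lab L) : R :=
  if n is n'.+1 then \sum_(i in t [::]) w i * wsum H n' (shift [:: i] t) else H t.

Definition meanw := \sum_s p s * \sum_(i in s) w i.

Lemma Exr_single n s F i : Exr n s (fun t => F (shift [:: i] t)) = Ex n F.
Proof.
rewrite (@Exr_prod _ _ _ (fun k => if k == i then F else fun=> 1)).
  rewrite (bigD1 i)//= eqxx big1 ?mulr1// => k /negPf ->.
  exact: Ex_cst.
by move=> t _; rewrite (bigD1 i)//= eqxx big1 ?mulr1// => k /negPf ->.
Qed.

Lemma Exr_pair n s F i j : i != j ->
  Exr n s (fun t => F (shift [:: i] t) * F (shift [:: j] t)) = Ex n F ^+ 2.
Proof.
move=> ij; rewrite (@Exr_prod _ _ _ (fun k => if k \in [:: i; j] then F else fun=> 1)).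
  rewrite (bigD1 i)//= inE eqxx (bigD1 j) 1?eq_sym//= !inE eqxx orbT big1 ?mulr1 ?expr2//.
  by move=> k /andP[/negPf ki /negPf kj]; rewrite !inE ki kj Ex_cst.
move=> t _; rewrite (bigD1 i)//= inE eqxx (bigD1 j) 1?eq_sym//= !inE eqxx orbT big1 ?mulr1//.
by move=> k /andP[/negPf ki /negPf kj]; rewrite !inE ki kj.
Qed.

Lemma Ex_wsum H n N : Ex (n + N) (wsum H n) = meanw ^+ n * Ex N H.
Proof.
elim: n => [|n IH]; first by rewrite expr0 mul1r.
rewrite exprS -mulrA -IH addSn ExS mulr_suml; apply: eq_bigr => s _.
rewrite -mulrA; congr (_ * _).
rewrite (@eq_Exr _ _ _ (fun t => \sum_(i in s) w i * wsum H n (shift [:: i] t))) => [|t <-//].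
rewrite Exr_sum mulr_suml; apply: eq_bigr => i _.
by rewrite ExrZ Exr_single.
Qed.

Definition second_cst := \sum_s p s * (\sum_(i in s) w i) ^+ 2.

(** Expanding the square over pairs of children, distinct children are independent and give squared
    means, while the diagonal is controlled by [w i ^+ 2 <= w i]. *)
Lemma Ex_wsum_sqrS H n N :
  Ex (n.+1 + N) (fun t => wsum H n.+1 t ^+ 2) <=
  second_cst * Ex (n + N) (wsum H n) ^+ 2 + meanw * Ex (n + N) (fun t => wsum H n t ^+ 2).
Proof.
rewrite addSn ExS /second_cst /meanw !mulr_suml -big_split; apply: ler_sum => s _ /=.
rewrite -!mulrA -mulrDr ler_wpM2l//.
set F := wsum H n; set e := Ex _ F; set v := Ex _ (fun _ => F _ ^+ 2).
have v0 : 0 <= v by apply: Ex_ge0 => t; rewrite sqr_ge0.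
rewrite (@eq_Exr _ _ _ (fun t => \sum_(i in s) \sum_(j in s)
   (w i * w j) * (F (shift [:: i] t) * F (shift [:: j] t)))); last first.
  move=> t ts; rewrite /= ts expr2 mulr_suml; apply: eq_bigr => i _.
  by rewrite mulr_sumr; apply: eq_bigr => j _; rewrite mulrACA.
rewrite Exr_sum [X in _ <= X + _]mulr_suml [X in _ <= _ + X]mulr_suml -big_split; apply: ler_sum => i i_s /=.
rewrite Exr_sum (bigD1 i)//= ExrZ.
rewrite (_ : Exr _ _ _ = v); last first.
  rewrite /v -(@Exr_single _ s (fun t => F t ^+ 2) i).
  by apply: eq_Exr => t _; rewrite expr2.
rewrite addrC; have /andP[wi0 wi1] := w01 i.
apply: lerD; last by rewrite ler_wpM2r// ler_piMr.
rewrite mulr_suml mulr_sumr.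
rewrite [leRHS](bigD1 i)//=; apply: ler_wpDl.
  by rewrite mulr_ge0// mulr_ge0// sqr_ge0.
apply: ler_sum => j /andP[js ji]; rewrite ExrZ Exr_pair 1?eq_sym//.
by rewrite !mulrA.
Qed.

(** The factor [second_cst / (meanw ^+ 2 - meanw)] is the fixed point of the one-step recursion,
    which makes the bound reproduce itself exactly. The remaining term comes from level 0, where the
    square of an indicator is the indicator. *)
Lemma second_moment Q n N : 1 < meanw ->
  Ex (n + N) (fun t => wsum (ind Q) n t ^+ 2) <=
  meanw ^+ n ^+ 2 * (second_cst / (meanw ^+ 2 - meanw) * Pr N Q ^+ 2 + Pr N Q / meanw ^+ n).
Proof.
set h := Pr N Q; move=> m1; have m0 : 0 < meanw by lra.
have mm : 0 < meanw ^+ 2 - meanw by rewrite subr_gt0 expr2 ltr_pMl.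
have q0 : 0 <= second_cst / (meanw ^+ 2 - meanw).
  by rewrite divr_ge0 ?(ltW mm)// sumr_ge0// => s _; rewrite mulr_ge0 ?sqr_ge0.
elim: n => [|n IH].
  rewrite expr0 expr1n mul1r divr1; apply: ler_wpDl; first by rewrite mulr_ge0// sqr_ge0.
  apply: Ex_le => t /=; rewrite /ind; case: asboolP => _; rewrite ?expr1n ?expr0n//.
apply: le_trans (Ex_wsum_sqrS _ _ _) _; rewrite Ex_wsum -/h.
apply: le_trans (lerD (lexx _) (ler_wpM2l (ltW m0) IH)) _.
rewrite (exprS meanw n); set M := meanw ^+ n.
have M0 : 0 < M by rewrite exprn_gt0.
have -> : (meanw * M) ^+ 2 * (second_cst / (meanw ^+ 2 - meanw) * h ^+ 2 + h / (meanw * M)) =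
  second_cst * (M * h) ^+ 2 + meanw * (M ^+ 2 * (second_cst / (meanw ^+ 2 - meanw) * h ^+ 2 + h / M)).
  field; rewrite !gt_eqF//=; split=> //.
by [].
Qed.

Lemma expr_unbounded (x M : R) : 1 < x -> exists n, M <= x ^+ n.
Proof.
move=> x1; have [n Hn] : exists n : nat, M <= n%:R * (x - 1).
  exists (Num.truncn (`|M| / (x - 1))).+1.
  rewrite -ler_pdivrMr ?subr_gt0//; apply: le_trans (ltW (truncnS_gt _)).
  by rewrite ler_pM2r ?ler_norm// invr_gt0 subr_gt0.
exists n; apply: (le_trans Hn).
elim: n {Hn} => [|n IH]; first by rewrite mul0r.
have : 1 <= x ^+ n by rewrite exprn_ege1// ltW.
rewrite exprS -natr1 => h.
have : 0 <= (x - 1) * (x ^+ n - 1) by rewrite mulr_ge0 ?subr_ge0// ltW.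
by lra.
Qed.

(* Paley-Zygmund, via the pointwise bound [2 x - x^2 <= 1_(x >= 0)] applied to
   [x = alpha (Y - EY / 2)]. *)
Lemma paley_zygmund n F v : 0 < v -> 0 <= Ex n F -> Ex n (fun t => F t ^+ 2) <= v ->
  (Ex n F) ^+ 2 / (4 * v) <= Pr n [set t | Ex n F / 2 <= F t].
Proof.
set e := Ex n F => v0 e0 Hv; pose al := e / (2 * v).
have al0 : 0 <= al by rewrite divr_ge0// mulr_ge0 ?ltW.
apply: (@le_trans _ _ (Ex n (fun t => 2 * (al * (F t - e / 2)) - (al * (F t - e / 2)) ^+ 2))).
  rewrite (@eq_Ex _ _ (fun t => (2 * al + al ^+ 2 * e) * F t + (- al ^+ 2 * F t ^+ 2 +
     (- al * e - al ^+ 2 * e ^+ 2 / 4)))); last by move=> t; field.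
  rewrite !ExD !ExZ !Ex_cst -/e.
  apply: (@le_trans _ _ (al * e - al ^+ 2 * v)).
    by rewrite le_eqVlt; apply/orP; left; apply/eqP; rewrite /al; field; rewrite gt_eqF.
  have : al ^+ 2 * Ex n (fun t => F t ^+ 2) <= al ^+ 2 * v by rewrite ler_wpM2l ?sqr_ge0.
  have : 0 <= al ^+ 2 * e ^+ 2 by rewrite mulr_ge0 ?sqr_ge0.
  by lra.
apply: Ex_le => t; rewrite /ind /=; case: asboolP => [_|/negP].
  by have := sqr_ge0 (al * (F t - e / 2) - 1); rewrite /=; lra.
rewrite -ltNge => Fe.
have : 0 <= al * (e / 2 - F t) by rewrite mulr_ge0// subr_ge0 ltW.
by have := sqr_ge0 (al * (F t - e / 2)); rewrite /=; lra.
Qed.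

(** The order of quantifiers is the point: [c] precedes [h0] and [th]. Once [meanw ^+ n] exceeds
    [h0^-1], the second moment is at most a fixed multiple of the squared mean, and the
    Paley-Zygmund bound no longer sees how small [Pr N Q] is. *)
Lemma rich_descendants : 1 < meanw -> exists2 c, 0 < c &
  forall h0 th, 0 < h0 -> exists n, forall N Q, h0 <= Pr N Q ->
    c <= Pr (n + N) [set t | th <= wsum (ind Q) n t].
Proof.
move=> m1; have m0 : 0 < meanw by lra.
have mm : 0 < meanw ^+ 2 - meanw by rewrite subr_gt0 expr2 ltr_pMl.
pose q := second_cst / (meanw ^+ 2 - meanw) + 1.
have q1 : 1 <= q.
  by rewrite lerDr divr_ge0 ?(ltW mm)// sumr_ge0// => s _; rewrite mulr_ge0 ?sqr_ge0.
have q0 : 0 < q by apply: lt_le_trans q1.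
exists (8 * q)^-1; first by rewrite invr_gt0 mulr_gt0.
move=> h0 th h0_gt0.
(* The first bound absorbs [h / M] into [h ^+ 2]; the second makes half the mean exceed [th]. *)
have [n Hn] := expr_unbounded (Num.max (h0^-1) (2 * `|th| / h0)) m1.
exists n => N Q hQ; set h := Pr N Q in hQ *.
have h_gt0 : 0 < h by apply: lt_le_trans hQ.
have M0 : 0 < meanw ^+ n by rewrite exprn_gt0.
move: Hn; rewrite ge_max => /andP[Hn1 Hn2].
set M := meanw ^+ n in M0 Hn1 Hn2.
have eE : Ex (n + N) (wsum (ind Q) n) = M * h by rewrite Ex_wsum.
pose v := 2 * q * (M * h) ^+ 2.
have v0 : 0 < v by rewrite !mulr_gt0// exprn_gt0// mulr_gt0.
have := @paley_zygmund (n + N) (wsum (ind Q) n) v v0.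
rewrite eE; have -> : (M * h) ^+ 2 / (4 * v) = (8 * q)^-1.
  by rewrite /v; field; rewrite !gt_eqF.
move=> /(_ (ltW (mulr_gt0 M0 h_gt0))) PZ.
apply: le_trans (PZ _) _.
  apply: le_trans (second_moment _ _ _ m1) _; rewrite -/h -/M /v.
  rewrite (_ : 2 * q * _ = M ^+ 2 * (2 * q * h ^+ 2)); last by ring.
  rewrite ler_wpM2l ?sqr_ge0//.
  have hM : h / M <= h ^+ 2.
    rewrite ler_pdivrMr// expr2 -mulrA ler_pMr//.
    apply: (@le_trans _ _ (h0 * M)); last by rewrite ler_pM2r.
    by rewrite -ler_pdivrMl ?mulr1.
  have : 0 <= (q - 1) * h ^+ 2 by rewrite mulr_ge0 ?sqr_ge0// subr_ge0.
  rewrite /q; have := sqr_ge0 h; set X := second_cst / _; lra.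
apply: Pr_le => t /=; apply: le_trans.
apply: (le_trans (ler_norm _)).
move: Hn2; rewrite ler_pdivrMr// => Hn2.
have : M * h0 <= M * h by rewrite ler_pM2l.
lra.
Qed.

End Moments.

End FiniteExpectation.

(** * Iterates of the generating function *)

Section GeneratingFunction.
Variables (R : realType) (L : finType) (p : {set L} -> R).
Hypotheses (p_ge0 : forall s, 0 <= p s) (p_sum1 : \sum_s p s = 1).
Hypothesis supercritical : 1 < \sum_s p s * #|s|%:R.

Lemma branching_set : exists2 s, 0 < p s & (1 < #|s|)%N.
Proof.
apply: contrapT => H; move: supercritical; apply/negP; rewrite -leNgt -[leRHS]p_sum1.
apply: ler_sum => s _; have [ps|ps] := ltP 0 (p s).
  rewrite ler_piMr//; have [h|h] := ltnP 1 #|s|; first by case: H; exists s.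
  by rewrite lern1.
by have /le_anti -> : p s <= 0 <= p s; rewrite ?ps ?p_ge0// mul0r.
Qed.

Local Notation f := (pgf p).
Let m := \sum_s p s * #|s|%:R.
(** Divided difference of the generating function, as a polynomial with nonnegative coefficients;
    [slope 1 1] is the mean [m]. *)
Let slope u v := \sum_s p s * \sum_(i < #|s|) u ^+ (#|s|.-1 - i) * v ^+ i.

Let slopeE u v : f u - f v = (u - v) * slope u v.
Proof.
rewrite /pgf /slope -sumrB mulr_sumr; apply: eq_bigr => s _.
by rewrite -mulrBr subrXX mulrCA.
Qed.

Let pgf1 : f 1 = 1.
Proof. by rewrite -[RHS]p_sum1; apply: eq_bigr => s _; rewrite expr1n mulr1. Qed.

Lemma pgf_mono u v : 0 <= u -> u <= v -> f u <= f v.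
Proof. by move=> u0 uv; apply: ler_sum => s _; rewrite ler_wpM2l// lerXn2r// nnegrE// (le_trans u0). Qed.

Lemma pgf_ge0 u : 0 <= u -> 0 <= f u.
Proof. by move=> u0; apply: sumr_ge0 => s _; rewrite mulr_ge0// exprn_ge0. Qed.

Lemma iter_pgf_ge0 n u : 0 <= u -> 0 <= iter n f u.
Proof. by move=> u0; elim: n => //= n IH; exact: pgf_ge0. Qed.

Lemma iter_pgf_mono n u v : 0 <= u -> u <= v -> iter n f u <= iter n f v.
Proof. by move=> u0 uv; elim: n => //= n IH; rewrite pgf_mono// iter_pgf_ge0. Qed.

Let bernoulli (h : R) N : 0 <= h <= 1 -> 1 - N%:R * h <= (1 - h) ^+ N.
Proof.
case/andP=> h0 h1; elim: N => [|N IH]; first by rewrite mul0r subr0.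
rewrite exprS; have : 0 <= 1 - h by lra.
move=> /ler_wpM2l/(_ _ _ IH); apply: le_trans.
have : 0 <= N%:R * h ^+ 2 by rewrite mulr_ge0// sqr_ge0.
by rewrite -natr1; lra.
Qed.

(** The derivative at 1 is [m > 1], so just left of 1 the graph lies below the diagonal; [h] is
    taken so small that, by Bernoulli, the chord from [1 - h] to 1 still has slope at least 1. *)
Let invariant_point x : 0 <= x < 1 -> exists2 y, x <= y < 1 & f y <= y.
Proof.
case/andP=> x0 x1; have m1 : 1 < m := supercritical.
have m0 : 0 < m by lra.
pose h := Num.min (1 - x) ((1 - m^-1) / #|L|.+1%:R).
have mV : 0 < 1 - m^-1 by rewrite subr_gt0 invf_lt1.
have h0 : 0 < h by rewrite lt_min subr_gt0 x1 divr_gt0.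
have hx : h <= 1 - x by rewrite ge_min lexx.
have hm : #|L|%:R * h <= 1 - m^-1.
  apply: (@le_trans _ _ (#|L|.+1%:R * h)); first by rewrite ler_pM2r// ler_nat.
  by rewrite mulrC -ler_pdivlMr// ge_min lexx orbT.
exists (1 - h); first by apply/andP; split; lra.
have sl : 1 <= slope 1 (1 - h).
  apply: (@le_trans _ _ (m * (1 - h) ^+ #|L|)).
    rewrite -ler_pdivrMl// mulr1; apply: le_trans (bernoulli _ _); first by lra.
    by apply/andP; split; lra.
  rewrite /m /slope mulr_suml; apply: ler_sum => s _; rewrite -mulrA ler_wpM2l//.
  rewrite mulr_natl -[X in _ *+ X]card_ord -sumr_const; apply: ler_sum => i _.
  rewrite expr1n mul1r; apply: ler_wiXn2l; [lra|lra|].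
  by apply: leq_trans (max_card [in s]); apply: ltnW.
have : (1 - (1 - h)) * 1 <= (1 - (1 - h)) * slope 1 (1 - h).
  by apply: ler_wpM2l => //; lra.
rewrite -slopeE pgf1; lra.
Qed.

(* The gap is contracted at the rate [slope b a], which is at most
   [theta * slope 1 b], while [1 - b] evolves at the exact rate [slope 1 b]; the
   iterates of [y] stay away from 1. *)
Lemma pgf_iter_gap x e : 0 <= x < 1 -> 0 < e ->
  exists n, iter n f x - iter n f 0 < e.
Proof.
move=> x01 e0; have [y /andP[xy y1] fy] := invariant_point x01.
have x0 : 0 <= x by case/andP: x01.
have y0 : 0 <= y by exact: le_trans xy.
have m1 : 1 < m := supercritical.
have m0 : 0 < m by lra.
have [s2 ps2 s2_2] := branching_set.
have ps21 : p s2 <= 1.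
  by rewrite -[leRHS]p_sum1 (bigD1 s2)//= lerDl sumr_ge0.
(* The gain comes from one term: for [s2] and index 0, [slope 1 (b n)] has 1 where
   [slope (b n) (a n)] has a positive power of [b n <= y]. Division by [m], a bound for
   [slope 1 (b n)], makes the gain relative. *)
pose th := 1 - p s2 * (1 - y) / m.
have py1 : p s2 * (1 - y) <= 1 by rewrite mulr_ile1//; lra.
have th0 : 0 < th by rewrite subr_gt0 ltr_pdivrMr// mul1r; lra.
have th1 : th < 1 by rewrite ltrBlDr ltrDl divr_gt0// mulr_gt0// subr_gt0.
pose b n := iter n f y; pose a n := iter n f 0.
have a0 n : 0 <= a n by exact: iter_pgf_ge0.
have b0 n : 0 <= b n by exact: iter_pgf_ge0.
have ab n : a n <= b n by exact: iter_pgf_mono.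
have by_ n : b n <= y.
  by elim: n => //= n IH; apply: le_trans fy; apply: pgf_mono (b0 n) IH.
have slope_le n : slope (b n) (a n) <= th * slope 1 (b n).
  have bn1 : b n <= 1 by apply: le_trans (by_ n) (ltW y1).
  have term (s : {set L}) (i : 'I_#|s|) :
      b n ^+ (#|s|.-1 - i) * a n ^+ i <= 1 ^+ (#|s|.-1 - i) * b n ^+ i.
    rewrite expr1n ler_pM ?exprn_ge0 ?exprn_ile1// lerXn2r// nnegrE//.
  have sl_m : slope 1 (b n) <= m.
    rewrite /slope /m; apply: ler_sum => s _; rewrite ler_wpM2l//.
    rewrite -[X in X%:R]card_ord -sumr_const; apply: ler_sum => i _.
    by rewrite expr1n mul1r exprn_ile1.
  apply: (@le_trans _ _ (slope 1 (b n) - p s2 * (1 - y))).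
    rewrite /slope (bigD1 s2)//= [X in _ <= X - _](bigD1 s2)//= addrAC -mulrBr.
    apply: lerD; last by apply: ler_sum => s _; rewrite ler_wpM2l// ler_sum.
    rewrite ler_wpM2l//; have i0 : (0 < #|s2|)%N by exact: ltnW.
    rewrite (bigD1 (Ordinal i0))//= [X in _ <= X - _](bigD1 (Ordinal i0))//= addrAC.
    apply: lerD; last exact: ler_sum.
    rewrite expr0 !mulr1 expr1n subn0 subKr.
    apply: le_trans (by_ n); case: #|s2| s2_2 => [|[|k]]// _ /=.
    by rewrite exprS ler_piMr// exprn_ile1.
  rewrite /th mulrBl mul1r lerD2l lerN2 -[leLHS]mulrA ler_piMr//.
    by rewrite mulr_ge0// ?ltW// subr_gt0.
  by rewrite mulrC ler_pdivrMr// mul1r.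
have claim n : (b n - a n) * (1 - y) <= th ^+ n * (1 - b n).
  elim: n => [|n IH]; first by rewrite /b /a /= expr0 mul1r subr0 ler_piMl//; lra.
  rewrite /b /a /= -/(b n) -/(a n) slopeE mulrAC.
  have -> : 1 - f (b n) = (1 - b n) * slope 1 (b n) by rewrite -slopeE pgf1.
  have s0 : 0 <= slope (b n) (a n).
    apply: sumr_ge0 => s _; rewrite mulr_ge0// sumr_ge0// => i _.
    by rewrite mulr_ge0// exprn_ge0.
  apply: le_trans (ler_wpM2r s0 IH) _.
  rewrite (_ : th ^+ n.+1 * _ = th ^+ n * (1 - b n) * (th * slope 1 (b n))).
    rewrite ler_wpM2l// mulr_ge0 ?exprn_ge0 ?(ltW th0)// subr_ge0.
    by apply: le_trans (by_ n) (ltW y1).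
  by rewrite exprS; ring.
have th1V : 1 < th^-1 by rewrite invf_gt1.
have [n Hn] := expr_unbounded (2 / (e * (1 - y))) th1V.
exists n; apply: (@le_lt_trans _ _ (b n - a n)); first by rewrite lerB// iter_pgf_mono.
have y1' : 0 < 1 - y by lra.
rewrite -(ltr_pM2r y1'); apply: le_lt_trans (claim n) _.
move: Hn; rewrite exprVn ler_pdivrMr ?mulr_gt0// mulrC ler_pdivlMr ?exprn_gt0// => Hn.
have : th ^+ n * (1 - b n) <= th ^+ n * 1.
  by rewrite ler_wpM2l ?exprn_ge0 ?(ltW th0)// lerBlDr lerDl.
have : 0 < e * (1 - y) by rewrite mulr_gt0.
lra.
Qed.

End GeneratingFunction.

(** * Events read off from finitely many levels *)

Section FiniteDependence.
Variable L : finType.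
Implicit Types (t : lab L) (Q : set (lab L)).

Fixpoint words n : seq (seq L) :=
  if n is n'.+1 then [::] :: [seq i :: w | i <- enum L, w <- words n'] else [::].

Lemma mem_words n w : (w \in words n) = (size w < n)%N.
Proof.
elim: n w => [|n IH] [|i w] //=; rewrite inE /=.
apply/allpairsP/idP => [[[j u] [_ ju [_ ->]]]|iw]; first by rewrite IH in ju.
by exists (i, w); rewrite mem_enum IH.
Qed.

Lemma uniq_words n : uniq (words n).
Proof.
elim: n => //= n IH; apply/andP; split.
  by apply/negP => /allpairsP[[i w] []].
by apply: allpairs_uniq; rewrite ?enum_uniq// => -[i w] [j u] _ _ /= [-> ->].
Qed.

Definition agree n t t' := forall u, (size u < n)%N -> t u = t' u.
Definition depends_below n Q := forall t t', agree n t t' -> Q t -> Q t'.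

Lemma agree_sym n t t' : agree n t t' -> agree n t' t.
Proof. by move=> a u un; rewrite a. Qed.

Lemma agree_le n m t t' : (m <= n)%N -> agree n t t' -> agree m t t'.
Proof. by move=> mn a u um; apply/a/(leq_trans um). Qed.

Lemma agree_shift n w t t' : agree (size w + n) t t' -> agree n (shift w t) (shift w t').
Proof. by move=> a u un; apply: a; rewrite size_cat ltn_add2l. Qed.

Lemma agree_intree w t t' : agree (size w) t t' -> intree t w = intree t' w.
Proof.
elim: w t t' => //= i w IH t t' a; rewrite a//; congr andb; apply: IH.
exact: (@agree_shift _ [:: i]).
Qed.

Lemma depends_belowC n Q : depends_below n Q -> depends_below n (~` Q).
Proof. by move=> dQ t t' /agree_sym a nQ Qt'; apply: nQ; apply: dQ a Qt'. Qed.

Lemma depends_below_all_at n N Q : depends_below N Q -> depends_below (n + N) (all_at n Q).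
Proof.
move=> dQ t t' a H w wn; rewrite -(@agree_intree w t) => [it|].
  by apply: dQ (H w wn it); apply: agree_shift; rewrite wn.
by apply: agree_le a; rewrite wn leq_addr.
Qed.

Fixpoint cut n (t : lab L) : conf L n :=
  if n is n'.+1 return conf L n then (t [::], [ffun i => cut n' (shift [:: i] t)]) else tt.

Lemma emb_cut n t u : (size u < n)%N -> emb (cut n t) u = t u.
Proof. by elim: n t u => // n IH t [|i u] //= un; rewrite ffunE IH. Qed.

Lemma cut_eq n t (c : conf L n) : cut n t = c <-> {in words n, forall u, t u = emb c u}.
Proof.
split=> [<- u|]; first by rewrite mem_words => un; rewrite emb_cut.
elim: n t c => [|n IH] t c H; first by case: c H.
case: c H => s f H; rewrite /=; congr pair; first by rewrite H// mem_words.
apply/ffunP => i; rewrite ffunE; apply: IH => u; rewrite mem_words => un.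
by rewrite /shift H// mem_words.
Qed.

Lemma depends_below_cut n Q t : depends_below n Q -> Q (emb (cut n t)) <-> Q t.
Proof. by move=> dQ; split; apply: dQ => u un; rewrite emb_cut. Qed.

(** Each of the finitely many points that ever leaves the sequence does so at a finite stage. This
    exchanges a choice made for each [k] with one valid for all [k]. *)
Lemma decreasing_stable (T : eqType) (s : seq T) (G : nat -> set T) :
  (forall k, G k.+1 `<=` G k) ->
  exists K, forall v, v \in s -> G K v -> forall k, G k v.
Proof.
move=> Gdec; have Gle m n v : (m <= n)%N -> G n v -> G m v.
  move=> /subnK <-; elim: (n - m)%N => //= k IH Gv; apply: IH; exact: Gdec.
elim: s => [|v s [K HK]]; first by exists 0%N.
have [Gv|/existsNP[k Gv]] := pselect (forall k, G k v).
  by exists K => u; rewrite inE => /orP[/eqP ->//|]; exact: HK.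
exists (maxn k K) => u; rewrite inE => /orP[/eqP ->|us] Gu.
  by case: Gv; apply: Gle Gu; rewrite leq_maxl.
by apply: HK us _; apply: Gle Gu; rewrite leq_maxr.
Qed.

Lemma prod_words (R : realType) (g : seq L -> R) n :
  \prod_(w <- words n.+1) g w = g [::] * \prod_i \prod_(w <- words n) g (i :: w).
Proof. by rewrite big_cons big_allpairs_dep big_enum. Qed.

Lemma pw_words (R : realType) (p : {set L} -> R) n (c : conf L n) :
  pw p c = \prod_(w <- words n) p (emb c w).
Proof.
elim: n c => [|n IH] c; first by rewrite big_nil.
by rewrite prod_words /=; congr (_ * _); apply: eq_bigr => i _; rewrite IH.
Qed.

End FiniteDependence.

(** * Almost sure statements from truncated trees *)

Section GaltonWatson.
Variables (R : realType) (L : finType) (d0 : measure_display) (Om : measurableType d0).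
Variables (P : probability Om R) (W : seq L -> Om -> {set L}).
Hypothesis iidW : iid_offspring P W.

Definition offspring (s : {set L}) : R := fine (P [set om | W [::] om = s]).
Local Notation p := offspring.
Local Notation treeof om := (W^~ om).

Lemma offspringE a s : P [set om | W a om = s] = (p s)%:E.
Proof.
case: iidW => mW [eW _]; rewrite eW /p fineK// fin_num_measure//; exact: mW.
Qed.

Lemma offspring_ge0 s : 0 <= p s. Proof. exact: fine_ge0. Qed.

Let finite_union (T : finType) (A : {pred T}) (F : T -> set Om) :
  (forall c, measurable (F c)) -> trivIset setT F ->
  measurable (\bigcup_(c in [set` A]) F c) /\
  P (\bigcup_(c in [set` A]) F c) = (\sum_(c in A) P (F c))%E.
Proof.
move=> mF tF; split; first by apply: fin_bigcup_measurable => // c _; exact: mF.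
rewrite measure_fin_bigcup//.
  by rewrite -(@bigfs _ _ _ _ (index_enum T)) ?index_enum_uniq// => i _; rewrite mem_index_enum.
exact: sub_trivIset tF.
Qed.

Lemma offspring_sum1 : \sum_s p s = 1.
Proof.
case: iidW => mW _.
have [||_] := @finite_union {set L} predT (fun s => [set om | W [::] om = s]).
- by move=> s; exact: mW.
- by move=> s s' _ _ [om [/= e1 e2]]; rewrite -e1 -e2.
rewrite (_ : \bigcup_(_ in _) _ = setT); last by apply/seteqP; split=> // om _; exists (W [::] om).
rewrite probability_setT; under eq_bigr do rewrite offspringE.
by rewrite sumEFin => -[].
Qed.

Lemma cut_law n (c : conf L n) :
  measurable [set om | cut n (treeof om) = c] /\
  P [set om | cut n (treeof om) = c] = (pw p c)%:E.
Proof.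
have -> : [set om | cut n (treeof om) = c] =
    \bigcap_(a in [set` words L n]) [set om | W a om = emb c a].
  by apply/seteqP; split=> om /= /cut_eq.
case: iidW => mW [_ indep]; split.
  by apply: fin_bigcap_measurable => // a _; exact: mW.
rewrite -[LHS]fineK ?fin_num_measure//; last first.
  by apply: fin_bigcap_measurable => // a _; exact: mW.
rewrite indep ?uniq_words// pw_words; congr (_%:E); apply: eq_bigr => a _.
by rewrite offspringE.
Qed.

(** The bridge to the finite sums: the event is the disjoint union of the truncations that satisfy
    it. *)
Lemma event_law n (Q : set (lab L)) : depends_below n Q ->
  measurable [set om | Q (treeof om)] /\
  P [set om | Q (treeof om)] = (Pr p n Q)%:E.
Proof.
move=> dQ; pose A := [pred c : conf L n | `[< Q (emb c) >]].
have -> : [set om | Q (treeof om)] =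
    \bigcup_(c in [set` A]) [set om | cut n (treeof om) = c].
  apply/seteqP; split=> [om Qom|om [c /asboolP Qc /= cE]].
    by exists (cut n (treeof om)) => //; apply/asboolP/depends_below_cut.
  by rewrite -cE in Qc; apply/(depends_below_cut _ dQ).
have [|mA ->] := @finite_union _ A (fun c => [set om | cut n (treeof om) = c]) (fun c => (cut_law c).1).
  by move=> c c' _ _ [om [/= e1 e2]]; rewrite -e1 -e2.
split=> //; under eq_bigr do rewrite (cut_law _).2.
rewrite sumEFin big_mkcond; congr (_%:E); apply: eq_bigr => c _.
by rewrite inE /ind; case: asboolP; rewrite ?mulr1 ?mulr0.
Qed.

(** Reduces a null statement about the infinite tree to measurable covers of small probability,
    which can be events of finite depth or countable unions of them. *)
Lemma ae_not_small (B : set Om) :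
  (forall e, 0 < e -> exists A, [/\ measurable A, B `<=` A & (P A <= e%:E)%E]) ->
  P.-negligible B.
Proof.
move=> H; have /choice[A HA] n : exists A, [/\ measurable A, B `<=` A & (P A <= (n.+1%:R^-1)%:E)%E].
  by apply: H; rewrite invr_gt0.
exists (\bigcap_n A n); split.
- by apply: bigcap_measurable => // n _; case: (HA n).
- apply/eqP; rewrite eq_le measure_ge0 andbT; apply/lee_addgt0Pr => e e0.
  rewrite add0e; pose n := Num.truncn e^-1; have [mA _ PA] := HA n.
  apply: le_trans (_ : P (A n) <= _)%E.
    apply: le_measure; rewrite ?inE//; last exact: bigcap_inf.
    by apply: bigcap_measurable => // k _; case: (HA k).
  apply: le_trans PA _; rewrite lee_fin invf_ple ?posrE//.
  by apply/ltW/truncnS_gt.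
- by move=> om Bom n _; case: (HA n) => _ + _; apply.
Qed.

Hypothesis supercritical : 1 < \sum_s p s * #|s|%:R.

(** Reaching level [n] with no vertex of [G k] there has probability at most [f^n(1 - q) - f^n(0)],
    for [f] the generating function, and [pgf_iter_gap] makes this gap small. The bound is uniform
    in [k], so it passes to the increasing union over [k]. *)
Lemma survival_reaches (G : nat -> set (lab L)) q : 0 < q ->
  (forall k, G k.+1 `<=` G k) ->
  (forall k, exists2 N, depends_below N (G k) & q <= Pr p N (G k)) ->
  {ae P, forall om, nonextinct W om ->
    exists2 v, intree (treeof om) v & forall k, G k (shift v (treeof om))}.
Proof.
move=> q0 Gdec GP; apply: ae_not_small => e e0.
have q1 : q <= 1.
  by have [N _ h] := GP 0%N; apply: le_trans h (Pr_le1 offspring_ge0 offspring_sum1 _ _).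
have [n Hn] : exists n, iter n (pgf p) (1 - q) - iter n (pgf p) 0 < e.
  by apply: pgf_iter_gap => //; [exact: offspring_ge0|exact: offspring_sum1|apply/andP; split; lra].
pose A k := [set om | all_at n (~` G k) (treeof om)].
pose X := [set om | all_at n set0 (treeof om)].
have mX : measurable X /\ P X = (iter n (pgf p) 0)%:E.
  have [|mX ->] := @event_law (n + 0) (all_at n set0).
    by apply: depends_below_all_at => t t' _.
  split=> //; rewrite Pr_all_at//; [|exact: offspring_sum1].
  congr (iter _ _ _)%:E; rewrite /Pr /Ex big1// => c _.
  by rewrite /ind asboolF ?mulr0.
have mA k : measurable (A k) /\ (P (A k) <= (iter n (pgf p) (1 - q))%:E)%E.
  have [N dN qN] := GP k.
  have [|mA ->] := @event_law (n + N) (all_at n (~` G k)).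
    by apply: depends_below_all_at; exact: depends_belowC.
  split=> //; rewrite Pr_all_at//; last exact: offspring_sum1.
  rewrite lee_fin iter_pgf_mono ?Pr_ge0//; try exact: offspring_ge0; try exact: offspring_sum1.
  rewrite PrC//; last exact: offspring_sum1.
  by lra.
have XA k : X `<=` A k by move=> om H w wn iw; case: (H w wn iw).
have mAX k : measurable (A k `\` X) by apply: measurableD; [case: (mA k)|case: mX].
have mU : measurable (\bigcup_k (A k `\` X)) by exact: bigcup_measurable.
exists (\bigcup_k (A k `\` X)); split=> //.
  move=> om /not_implyP[ne nv].
  (* If no vertex of level [n] lies in every [G k], then already for one [K] none of them lies in
     [G K]. *)
  have [K HK] := decreasing_stable (words L n.+1)
    (fun k v => Gdec k (shift v (treeof om)) : G k.+1 (shift v (treeof om)) -> G k (shift v (treeof om))).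
  exists K => //; split.
    move=> w wn iw GK; apply: nv; exists w => //; apply: HK => //.
    by rewrite mem_words wn.
  move=> H; have [w [wn /in_treeP iw]] := ne n.
  by case: (H w wn iw).
have homo : {homo (fun k => A k `\` X) : i j / (i <= j)%N >-> (i <= j)%O}.
  move=> i j ij; apply/subsetPset => om [H nX]; split=> // w wn iw Gj; apply: (H w wn iw).
  by move: Gj; move: ij => /subnK <-; elim: (j - i)%N => //= k IH Gj; apply: IH; exact: Gdec.
apply: (cvge_le _ (nondecreasing_cvg_mu mAX mU homo)).
apply: nearW => k /=; rewrite measureD; [|by case: (mA k)|by case: mX|]; last first.
  by rewrite -ge0_fin_numE// fin_num_measure//; case: (mA k).
rewrite (setIidr (XA k)); case: (mA k) => _ PAk; case: mX => _ PX.
have PX' : ((iter n (pgf p) 0)%:E <= P X)%E by rewrite PX.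
apply: le_trans (leeB PAk PX') _.
by rewrite -EFinB lee_fin ltW.
Qed.

End GaltonWatson.

(** * Dimension from below *)

Section Sequences.
Variable T : eqType.

Lemma finite_listing (P : set T) N :
  (forall ps : seq T, uniq ps -> (forall p, p \in ps -> P p) -> (size ps <= N)%N) ->
  exists Q : seq T, [/\ uniq Q, (size Q <= N)%N & forall p, p \in Q <-> P p].
Proof.
elim: N P => [|N IH] P HP.
  exists [::]; split=> // p; split=> // Pp.
  suff : (size [:: p] <= 0)%N by [].
  by apply: HP => // q; rewrite inE => /eqP ->.
have [[p0 Pp0]|nP] := pselect (exists p, P p); last first.
  by exists [::]; split=> // p; split=> // Pp; case: nP; exists p.
have [|Q [uQ sQ QE]] := IH (P `\ p0).
  move=> ps ups Pps; have := HP (p0 :: ps); apply.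
    by rewrite /= ups andbT; apply/negP => /Pps [_]; apply.
  by move=> p; rewrite inE => /orP[/eqP -> //|/Pps []].
exists (p0 :: Q); split=> //=.
  by rewrite uQ andbT; apply/negP => /QE [_]; apply.
move=> p; rewrite inE; split=> [/orP[/eqP -> //|/QE []//]|Pp].
by have [//|pp0] := eqVneq p p0; apply/QE; split=> //; apply/eqP.
Qed.

Lemma path_exists (I : set (seq T)) : I [::] ->
  (forall p, I p -> exists b, I (rcons p b)) ->
  exists f : nat -> T, forall n, I (mkseq f n).
Proof.
move=> I0 IS; have [b0 _] := IS _ I0.
have /choice[g gP] p : exists b, I p -> I (rcons p b).
  by have [/IS[b Ib]|nI] := pselect (I p); [exists b|exists b0].
pose q n := iter n (fun p => rcons p (g p)) [::].
exists (g \o q) => n; suff -> : mkseq (g \o q) n = q n by elim: n => //= n /gP.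
by elim: n => //= n IH; rewrite mkseqS IH.
Qed.

(** A word extends at most one child of [p]; this is the superadditivity of the charge used
    below. *)
Lemma sum_prefix_rcons (s : seq T) p (Q : seq (seq T)) : uniq s ->
  (\sum_(b <- s) count (prefix (rcons p b)) Q <= count (prefix p) Q)%N.
Proof.
move=> us; elim: Q => [|q Q IH] /=; first by rewrite big1.
rewrite big_split /= leq_add//.
have -> : (\sum_(b <- s) prefix (rcons p b) q = count (fun b => prefix (rcons p b) q) s)%N.
  by rewrite -sum1_count [RHS]big_mkcond; apply: eq_bigr => b _; case: prefix.
have [/hasP[b0 _ pb0]|nh] := boolP (has (fun b => prefix (rcons p b) q) s); last first.
  by move: nh; rewrite has_count -eqn0Ngt => /eqP ->.
rewrite (prefix_trans (prefix_rcons p b0) pb0).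
apply: (@leq_trans (count_mem b0 s)); last by rewrite count_uniq_mem// leq_b1.
apply: sub_count => b; move: pb0; rewrite !prefixE !size_rcons => /eqP -> /eqP.
by move/rcons_inj => [->] /=.
Qed.

End Sequences.

Section MassDistribution.
Variables (R : realType) (d : nat) (B : choiceType).
Variables (ch : seq B -> seq B) (rho : seq B -> R) (cyl : seq B -> set 'rV[R]_d).

Definition valid_path (p : seq B) : Prop :=
  forall u b v, p = u ++ b :: v -> b \in ch u.

(** When [rho] decreases along paths, this selects the first node of size at most [delta]. *)
Definition stops (delta : R) (p : seq B) : Prop :=
  rho p <= delta /\ forall u b, p = rcons u b -> delta < rho u.

Lemma valid_rcons p b : valid_path (rcons p b) <-> valid_path p /\ b \in ch p.
Proof.
split=> [vp|[vp bp] u b' v].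
  split=> [u b' v e|]; last by apply: (vp p b [::]); rewrite cats1.
  by apply: (vp u b' (rcons v b)); rewrite e rcons_cat.
case/lastP: v => [|v b'']; first by rewrite cats1 => /rcons_inj[e1 e2]; rewrite -e1 -e2.
by rewrite -rcons_cons -rcons_cat => /rcons_inj[e1 _]; apply: (vp _ _ v).
Qed.

Lemma hterm_ge0 (t : R) (F : set 'rV[R]_d) : (0 <= hterm t F)%E.
Proof. by rewrite /hterm; case: pselect => h; rewrite ?lee_fin ?powR_ge0. Qed.

(** A covering set may be a single point, whereas stopping needs a positive size; the diameter is
    replaced by a positive [delta] at cost at most [e]. *)
Lemma diam_approx (t e : R) (F : set 'rV[R]_d) : 0 <= t -> 0 < e -> bounded_by F 1 -> F !=set0 ->
  exists delta, [/\ 0 < delta, bounded_by F delta & ((delta `^ t)%:E <= hterm t F + e%:E)%E].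
Proof.
move=> t0 e0 F1 [x0 Fx0].
have Fd : bounded_by F (rdiam F).
  move=> x y Fx Fy; apply: ub_le_sup; last by exists x => //; exists y.
  by exists 1 => _ [a Fa [b Fb <-]]; exact: F1.
have Fn : F <> set0 by move=> F0; rewrite F0 in Fx0.
have -> : hterm t F = (rdiam F `^ t)%:E by rewrite /hterm; case: pselect.
have d0 : 0 <= rdiam F by apply: le_trans (Fd x0 x0 Fx0 Fx0); rewrite enorm_ge0.
have [d_gt0|] := ltP 0 (rdiam F).
  by exists (rdiam F); split=> //; rewrite -EFinD lee_fin lerDl ltW.
move=> d_le0; have {d_le0 d0} d0 : rdiam F = 0 by apply/le_anti; rewrite d_le0 d0.
rewrite d0 in Fd *; have bnd delta : 0 < delta -> bounded_by F delta.
  by move=> de x y Fx Fy; apply: le_trans (Fd x y Fx Fy) (ltW de).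
(* At diameter 0 the cost is 1 for [t = 0] and 0 otherwise; only in the second case must [delta] be
   small. *)
have [->|tn0] := eqVneq t 0.
  by exists 1; split=> //; rewrite !powRr0 -EFinD lee_fin lerDl ltW.
exists (e `^ t^-1); split; [by rewrite powR_gt0|by apply: bnd; rewrite powR_gt0|].
by rewrite -powRrM mulVf// powRr1 ?(ltW e0)// powR0// add0e.
Qed.

Hypothesis rho_gt0 : forall p, 0 < rho p.
Hypothesis ch_uniq : forall p, valid_path p -> uniq (ch p).
Hypothesis rho_lim : forall f, (forall n, valid_path (mkseq f n)) ->
  forall delta, 0 < delta -> exists n, rho (mkseq f n) <= delta.

(* The functional [c] charges a node with the total weight of the covering sets
   stopped below it.  It is superadditive along the tree while [rho ^ t] is
   subadditive, so a cheap cover leaves a path along which [c < rho ^ t], and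
   such a path never meets a stopped node: its limit point is not covered. *)
Lemma hausdorff_measure_neq0 (t : R) (X : set 'rV[R]_d) : 0 <= t ->
  (forall p, valid_path p -> rho p `^ t <= \sum_(b <- ch p) rho (rcons p b) `^ t) ->
  (forall f, (forall n, valid_path (mkseq f n)) ->
    exists2 x, X x & forall n, cyl (mkseq f n) x) ->
  (exists N, forall F delta, 0 < delta -> bounded_by F delta ->
    forall ps, uniq ps ->
    (forall p, p \in ps -> [/\ valid_path p, stops delta p & cyl p `&` F !=set0]) ->
    (size ps <= N)%N) ->
  hausdorff_measure t X <> 0%E.
Proof.
move=> t0 Hw HX [N HN] HX0.
(* The cover costs less than [e0], the errors [eps n] sum to [e0], and each set stops at most [N]
   nodes: the charge of the root is at most [2 * N * e0], which is below [rho [::] ^ t]. *)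
pose e0 := rho [::] `^ t / (2 * N.+1%:R).
have r0 : 0 < rho [::] `^ t by rewrite powR_gt0.
have e0_gt0 : 0 < e0 by rewrite divr_gt0// mulr_gt0// ltr0n.
have [F [XF F1] Fe0] : exists2 F : nat -> set 'rV[R]_d,
    X `<=` \bigcup_n F n /\ (forall n, bounded_by (F n) 1) &
    (\sum_(0 <= n <oo) hterm t (F n) < e0%:E)%E.
  have : (hausdorff_delta t 1 X < e0%:E)%E.
    apply: (@le_lt_trans _ _ 0%E); last by rewrite lte_fin.
    by rewrite -HX0; apply: ereal_sup_ubound; exists 1 => //=.
  by move=> /ereal_inf_lt[_ [F HF <-] Fe]; exists F.
pose eps n : R := e0 / (2 ^ n.+1)%:R.
have eps0 n : 0 < eps n by rewrite divr_gt0// ltr0n expn_gt0.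
have /choice[D HD] n : exists D : R * seq (seq B), [/\ 0 < D.1,
    (size D.2 <= N)%N,
    ((D.1 `^ t * (size D.2)%:R)%:E <= N%:R%:E * (hterm t (F n) + (eps n)%:E))%E &
    forall p, p \in D.2 <-> [/\ valid_path p, stops D.1 p & cyl p `&` F n !=set0]].
  have [F0|Fn0] := pselect (F n = set0).
    exists (1, [::]); split=> //=.
      by rewrite mulr0 mule_ge0// ?lee_fin// adde_ge0 ?hterm_ge0// lee_fin ltW.
    by move=> p; split=> // -[_ _]; rewrite F0 setI0 => -[].
  have [|delta [de0 Fde dee]] := diam_approx t0 (eps0 n) (F1 n).
    by apply/set0P/eqP.
  have [|Q [uQ sQ QE]] := @finite_listing _ [set p | [/\ valid_path p, stops delta p & cyl p `&` F n !=set0]] N.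
    by move=> ps ups Hps; exact: HN de0 Fde ps ups Hps.
  exists (delta, Q); split=> //=.
  rewrite mulrC EFinM; apply: lee_pmul => //; rewrite ?lee_fin ?powR_ge0//.
  by rewrite ler_nat.
pose cn p n : \bar R := ((D n).1 `^ t * (count (prefix p) (D n).2)%:R)%:E.
pose c p : \bar R := (\sum_(0 <= n <oo) cn p n)%E.
have cn0 p n : (0 <= cn p n)%E by rewrite lee_fin mulr_ge0 ?powR_ge0.
have c_root : (c [::] < (rho [::] `^ t)%:E)%E.
  apply: (@le_lt_trans _ _ (N%:R%:E * (\sum_(0 <= n <oo) hterm t (F n) + e0%:E))%E).
    apply: (@le_trans _ _ (\sum_(0 <= n <oo) (N%:R%:E * (hterm t (F n) + (eps n)%:E)))%E).
      apply: lee_nneseries => [n _ _|n _]; first exact: cn0.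
      have [_ _ + _] := HD n; apply: le_trans; rewrite lee_fin ler_wpM2l ?powR_ge0//.
      by rewrite ler_nat count_size.
    rewrite nneseriesZl => [|n _]; last by rewrite adde_ge0 ?hterm_ge0// lee_fin ltW.
    apply: lee_wpmul2l; first by rewrite lee_fin.
    apply: epsilon_trick => [n|]; [exact: hterm_ge0|exact: ltW].
  have S0 : (0 <= \sum_(0 <= n <oo) hterm t (F n))%E.
    by apply: nneseries_ge0 => n _ _; exact: hterm_ge0.
  move: Fe0 S0; case: (\sum_(0 <= n <oo) _)%E => // S; rewrite lte_fin lee_fin => Se0 S0.
  rewrite -EFinD -EFinM lte_fin.
  apply: (@le_lt_trans _ _ (N%:R * (2 * e0))); first by rewrite ler_wpM2l//; lra.
  rewrite /e0 (_ : N%:R * _ = rho [::] `^ t * (N%:R / N.+1%:R)); last first.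
    have : N.+1%:R != 0 :> R by rewrite pnatr_eq0.
    by set M := N.+1%:R => M0; field.
  by rewrite gtr_pMr// ltr_pdivrMr// mul1r ltr_nat.
pose I p := valid_path p /\ (c p < (rho p `^ t)%:E)%E.
(* A node of [(D n).2] is a prefix of itself, so it is charged at least [(D n).1 ^ t], which is at
   least [rho p ^ t]. *)
have Inot p : I p -> forall n, p \notin (D n).2.
  move=> [vp cp] n; apply/negP => pD; move: cp; apply/negP; rewrite -leNgt.
  have [D0 _ _ /(_ p)[/(_ pD) [_ [rp _] _] _]] := HD n.
  apply: (@le_trans _ _ (cn p n)).
    rewrite lee_fin -[leLHS]mulr1; apply: ler_pM => //; rewrite ?powR_ge0//.
      by apply: ge0_ler_powR => //; rewrite nnegrE ltW.
    rewrite ler1n -has_count; apply/hasP; exists p => //; exact: prefix_refl.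
  have := @nneseries_lim_ge _ (cn p) xpredT 0 n.+1 (fun k _ _ => cn0 p k); apply: le_trans.
  by rewrite big_nat_recr//= leeDr// sume_ge0.
have IS p : I p -> exists b, I (rcons p b).
  move=> [vp cp]; apply: contrapT => H; move: cp; apply/negP; rewrite -leNgt.
  have Hb b : b \in ch p -> ((rho (rcons p b) `^ t)%:E <= c (rcons p b))%E.
    move=> bp; rewrite leNgt; apply/negP => lt; apply: H; exists b; split=> //.
    exact/valid_rcons.
  apply: (@le_trans _ _ (\sum_(b <- ch p) c (rcons p b))%E).
    apply: (@le_trans _ _ (\sum_(b <- ch p) rho (rcons p b) `^ t)%:E).
      by rewrite lee_fin Hw.
    rewrite -sumEFin big_seq [leRHS]big_seq; apply: lee_sum => b; exact: Hb.
  rewrite /c -nneseries_sum; last by move=> b n _; exact: cn0.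
  apply: lee_nneseries => [n _ _|n _]; first by apply: sume_ge0 => b _; exact: cn0.
  rewrite /cn sumEFin lee_fin -mulr_sumr ler_wpM2l ?powR_ge0// -natr_sum ler_nat.
  exact/sum_prefix_rcons/ch_uniq.
have [|f fI] := path_exists (I := I) _ IS.
  by split=> // u b v; case: u.
have fv n : valid_path (mkseq f n) by case: (fI n).
have [x Xx xcyl] := HX f fv.
have [n _ Fx] := XF x Xx; have [D0 _ _ DE] := HD n.
(* The limit point of the path lies in some [F n]; the first node of the path of size at most
   [(D n).1] is then a stopped node, against [Inot]. *)
have exk : exists k, rho (mkseq f k) <= (D n).1 by exact: rho_lim.
have [k rk kmin] := ex_minnP exk.
have := Inot _ (fI k) n; apply/negP; rewrite negbK; apply/DE; split=> //.
  split=> // u b; case: k rk kmin => [|k] rk kmin; first by case: u.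
  rewrite mkseqS => /rcons_inj[<- _]; rewrite ltNge; apply/negP => /kmin.
  by rewrite ltnn.
by exists x.
Qed.

End MassDistribution.

(** * Iterated function systems *)

Section IteratedFunctionSystem.
Variables (R : realType) (d : nat) (L : finType).
Variables (phi : L -> 'rV[R]_d -> 'rV[R]_d) (r : L -> R) (K : set 'rV[R]_d).
Hypotheses (simIFS : similarity_IFS phi r) (attK : is_attractor phi K).
Local Notation phiw := (phiw phi).

Definition rw (w : seq L) : R := \prod_(i <- w) r i.
Definition cylK (w : seq L) : set 'rV[R]_d := phiw w @` K.

Lemma rw_nil : rw [::] = 1. Proof. by rewrite /rw big_nil. Qed.

Lemma rw_cons i w : rw (i :: w) = r i * rw w. Proof. by rewrite /rw big_cons. Qed.

Lemma rw_cat u v : rw (u ++ v) = rw u * rw v. Proof. by rewrite /rw big_cat. Qed.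

Lemma rw_gt0 w : 0 < rw w.
Proof. by apply: prodr_gt0 => i _; case: (simIFS i) => /andP[]. Qed.

Lemma rw_le1 w : rw w <= 1.
Proof.
elim: w => [|i w IH]; first by rewrite rw_nil.
by rewrite rw_cons mulr_ile1// ltW ?rw_gt0//; case: (simIFS i) => /andP[].
Qed.

Lemma ratio_bounds : exists rmin rmax : R,
  [/\ 0 < rmin, 0 < rmax < 1, rmin <= 1 & forall i, rmin <= r i <= rmax].
Proof.
have r0 i : 0 < r i by case: (simIFS i) => /andP[].
have r1 i : r i < 1 by case: (simIFS i) => /andP[].
(* Products serve as bounds that also make sense for an empty alphabet; halving [pi2] keeps [rmax]
   positive. *)
pose pi1 := \prod_i r i; pose pi2 := \prod_i (1 - r i).
have p1 : 0 < pi1 <= 1.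
  rewrite /pi1 prodr_gt0//=; apply: prodr_ile1 => i _; by rewrite !ltW.
have p2 : 0 < pi2 <= 1.
  rewrite prodr_gt0 => [|i _]; last by rewrite subr_gt0.
  rewrite /=; apply: prodr_ile1 => i _; by rewrite subr_ge0 ltW//= lerBlDr lerDl ltW.
exists pi1, (1 - pi2 / 2); split; [by case/andP: p1|by lra|by case/andP: p1|].
move=> i; apply/andP; split.
  rewrite /pi1 (bigD1 i)//=; apply: ler_piMr; first exact: ltW.
  by apply: prodr_ile1 => j _; rewrite !ltW.
have : pi2 <= 1 - r i.
  rewrite /pi2 (bigD1 i)//=; apply: ler_piMr; first by rewrite subr_ge0 ltW.
  by apply: prodr_ile1 => j _; rewrite subr_ge0 ltW//= lerBlDr lerDl ltW.
by move: p2 => /andP[]; lra.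
Qed.

Lemma rw_ge (rmin : R) w : 0 <= rmin -> (forall i, rmin <= r i) -> rmin ^+ size w <= rw w.
Proof.
move=> r0 rmin_r; elim: w => [|i w IH]; first by rewrite rw_nil.
by rewrite rw_cons exprS ler_pM// exprn_ge0.
Qed.

Lemma rw_le (rmax : R) w : (forall i, r i <= rmax) -> rw w <= rmax ^+ size w.
Proof.
move=> r_rmax; elim: w => [|i w IH]; first by rewrite rw_nil.
by rewrite rw_cons exprS ler_pM// ltW ?rw_gt0//; case: (simIFS i) => /andP[].
Qed.

Lemma rw_small e : 0 < e -> exists n, forall w, (n <= size w)%N -> rw w <= e.
Proof.
move=> e0; have [rmin [rmax [_ /andP[m0 m1] _ rr]]] := ratio_bounds.
have m1V : 1 < rmax^-1 by rewrite invf_gt1.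
have [n Hn] := expr_unbounded e^-1 m1V.
exists n => w nw; apply: (@le_trans _ _ (rmax ^+ n)).
  apply: le_trans (rw_le _ (fun i => (andP (rr i)).2)) _.
  by apply: ler_wiXn2l => //; exact: ltW.
by move: Hn; rewrite exprVn lef_pV2// posrE exprn_gt0.
Qed.

Lemma phiw_cat u v x : phiw (u ++ v) x = phiw u (phiw v x).
Proof. by elim: u => //= i u ->. Qed.

Lemma phiw_sim w x y : enorm (phiw w x - phiw w y) = rw w * enorm (x - y).
Proof.
elim: w => [|i w IH] /=; first by rewrite rw_nil mul1r.
by rewrite (simIFS i).2 IH rw_cons mulrA.
Qed.

Lemma phiw_surj w y : exists x, phiw w x = y.
Proof. exact: similarity_surj (rw_gt0 w) (phiw_sim w) y. Qed.

Lemma phiwK w x : K x -> K (phiw w x).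
Proof.
case: attK => _ [_ KE]; elim: w => //= i w IH Kx; rewrite KE.
by exists i => //; exists (phiw w x) => //; exact: IH.
Qed.

Lemma cylK_cat u v : cylK (u ++ v) `<=` cylK u.
Proof. by move=> _ [x Kx <-]; exists (phiw v x); [exact: phiwK|rewrite phiw_cat]. Qed.

Lemma cylK_take n w : cylK w `<=` cylK (take n w).
Proof. by rewrite -{1}(cat_take_drop n w); exact: cylK_cat. Qed.

Lemma GW_fractal_sub (Om : Type) (W : seq L -> Om -> {set L}) om : GW_fractal phi K W om `<=` K.
Proof. by move=> x [j [_ /(_ 0%N) [y Ky <-]]]. Qed.

Lemma coding z : K z -> exists x : nat -> L, forall n, cylK (mkseq x n) z.
Proof.
move=> Kz; pose I w := cylK w z.
have [||f fI] := @path_exists _ I; last by exists f.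
  by exists z.
move=> w [y Ky wy]; case: attK => _ [_ KE]; move: Ky; rewrite {1}KE => -[i _ [x Kx xy]].
by exists i; exists x => //; rewrite -cats1 phiw_cat /= xy.
Qed.

(** The last clause says that the ball of radius [D * rw b] about [phiw b x0] lies in the ball of
    radius [D] about [x0], so that Bob's balls nest. The value of [D] solves [2 * C + rmax * D = D],
    where [2 * C] bounds distances in [K]. *)
Lemma bounding_ball : exists x0 (D : R), [/\ K x0, 0 < D,
  forall x, K x -> enorm (x - x0) <= D &
  forall b, enorm (phiw b x0 - x0) <= D - rw b * D].
Proof.
case: attK => -[x0 Kx0] [cK _].
have [C C0 KC] := compact_enorm_bounded cK.
have [rmin [rmax [_ /andP[m0 m1] _ rr]]] := ratio_bounds.
have m1' : 0 < 1 - rmax by lra.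
pose D := 2 * C / (1 - rmax).
have D0 : 0 < D by rewrite divr_gt0// mulr_gt0.
have CD : 2 * C = D * (1 - rmax) by rewrite /D mulfVK// gt_eqF.
have Kd x : K x -> enorm (x - x0) <= 2 * C.
  move=> Kx; apply: le_trans (enormD _ _) _; rewrite enormN.
  by have := KC _ Kx; have := KC _ Kx0; lra.
exists x0, D; split=> //.
  move=> x /Kd /le_trans; apply; rewrite CD ler_piMr ?ltW//; lra.
elim=> [|i b IH] /=; first by rewrite rw_nil mul1r !subrr enorm0.
apply: le_trans (enorm_triangle (phi i x0) _ _) _; rewrite (simIFS i).2 rw_cons.
have := Kd _ (phiwK [:: i] Kx0) => /= Ki.
have ri0 : 0 < r i by case: (simIFS i) => /andP[].
have := ler_wpM2l (ltW ri0) IH.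
have : r i * D <= rmax * D by rewrite ler_pM2r//; case/andP: (rr i).
by rewrite -mulrA; lra.
Qed.

(** Pulled back by [phiw w], the points [phiw (u k) x0] of the closed set [K] approach the preimage
    of [x]. *)
Lemma cylK_limit x0 w (u : nat -> seq L) x : K x0 ->
  (forall e, 0 < e -> exists k, enorm (x - phiw (w ++ u k) x0) <= e) -> cylK w x.
Proof.
move=> Kx0 Hx; have [z wz] := phiw_surj w x; exists z => //.
apply: closed_enorm; first by case: attK => _ [/compact_closed cl _]; apply: cl; exact: norm_hausdorff.
move=> e e0; have e0' : 0 < rw w * (e / 2) by rewrite mulr_gt0 ?rw_gt0 ?divr_gt0.
have [k] := Hx _ e0'; rewrite phiw_cat -wz phiw_sim ler_pM2l ?rw_gt0// => Hk.
by exists (phiw (u k) x0); [exact: phiwK|apply: le_lt_trans Hk _; lra].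
Qed.

Lemma cylK_off_hyperplane w : (forall a c, a != 0 -> ~ K `<=` hyperplane a c) ->
  forall a c, a != 0 -> exists2 y, cylK w y & ~ hyperplane a c y.
Proof.
move=> Kh a c a0; have [a' [c' [a0' E]]] := similarity_hyperplane c (rw_gt0 w) (phiw_sim w) a0.
apply: contrapT => H; apply: (Kh a' c' a0') => x Kx; apply/E.
by apply: contrapT => nh; apply: H; exists (phiw w x) => //; exists x.
Qed.

Lemma ball_nested x0 (D : R) w b z :
  (forall b, enorm (phiw b x0 - x0) <= D - rw b * D) ->
  enorm (z - phiw (w ++ b) x0) <= D * rw (w ++ b) -> enorm (z - phiw w x0) <= D * rw w.
Proof.
move=> HD Hz; apply: le_trans (enorm_triangle (phiw (w ++ b) x0) _ _) _.
rewrite {2}phiw_cat phiw_sim; move: Hz; rewrite rw_cat.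
have := ler_wpM2l (ltW (rw_gt0 w)) (HD b); lra.
Qed.

End IteratedFunctionSystem.

(** * The game on a good subtree *)

Section Game.
Variables (R : realType) (d : nat) (L : finType).
Variables (phi : L -> 'rV[R]_d -> 'rV[R]_d) (r : L -> R) (K : set 'rV[R]_d).
Hypotheses (simIFS : similarity_IFS phi r) (attK : is_attractor phi K).
Variables (x0 : 'rV[R]_d) (D : R).
Hypotheses (Kx0 : K x0) (D0 : 0 < D) (KD : forall x, K x -> enorm (x - x0) <= D).
Hypothesis HD : forall b, enorm (phiw phi b x0 - x0) <= D - rw r b * D.
Variables (l : nat) (eta s kappa : R) (Sep : seq L -> seq L -> Prop).
Hypotheses (l0 : (0 < l)%N) (eta0 : 0 < eta) (s0 : 0 <= s) (kappa0 : 0 < kappa).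
Local Notation phiw := (phiw phi).
Local Notation rw := (rw r).
Local Notation cylK := (cylK phi K).

Definition far_from (a : 'rV[R]_d) (c : R) (y : 'rV[R]_d) (rad eps : R) :=
  forall z y', enorm (z - y) <= rad -> hyperplane a c y' -> eps <= enorm (z - y').

(** The list may depend on the hyperplane. [Sep] is a parameter because cylinders are kept apart in
    two ways: by a positive distance in general, by the open set under the open set condition. *)
Definition rich_blocks (Q : set (seq L)) := forall a c, a != 0 ->
  exists bs : seq (seq L), [/\ uniq bs,
    forall b, b \in bs -> [/\ size b = l, Q b & far_from a c (phiw b x0) (D * rw b) eta],
    forall b b', b \in bs -> b' \in bs -> b != b' -> Sep b b' &
    1 <= \sum_(b <- bs) rw b `^ s].

(** Bob can answer for [k] rounds. Only levels below [k * l] are read, so this is an event of finite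
    depth. *)
Fixpoint good (k : nat) : set (lab L) :=
  if k is k'.+1 then
    [set t | rich_blocks [set b | intree t b /\ good k' (shift b t)]]
  else setT.

Lemma rich_blocks_sub (Q Q' : set (seq L)) :
  (forall b, size b = l -> Q b -> Q' b) -> rich_blocks Q -> rich_blocks Q'.
Proof.
move=> QQ HQ a c a0; have [bs [ubs H1 H2 H3]] := HQ a c a0; exists bs; split=> // b bbs.
by have [sb Qb fb] := H1 _ bbs; split=> //; exact: QQ.
Qed.

Lemma good_dec k : good k.+1 `<=` good k.
Proof.
elim: k => // k IH t; apply: rich_blocks_sub => b _ [tb gb].
by split=> //; exact: IH.
Qed.

Lemma good_depends k : depends_below (k * l) (good k).
Proof.
elim: k => // k IH t t' a; apply: rich_blocks_sub => b bl [tb gb]; split.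
  by rewrite -(@agree_intree _ b t)//; apply: agree_le a; rewrite bl mulSn leq_addr.
by apply: IH gb; apply: agree_shift; rewrite bl -mulSn.
Qed.

(** For a given hyperplane the blocks granted by [good k.+1] may change with [k]; as there are
    finitely many blocks of length [l], those granted at a late stage are good for every [k]. *)
Lemma good_limit t : (forall k, good k t) ->
  rich_blocks [set b | intree t b /\ forall k, good k (shift b t)].
Proof.
move=> gt; have [k Hk] := decreasing_stable (words L l.+1)
  (fun k b => @good_dec k (shift b t) : good k.+1 (shift b t) -> good k (shift b t)).
apply: rich_blocks_sub (gt k.+1) => b bl [tb gb]; split=> //.
by apply: Hk gb; rewrite mem_words bl.
Qed.

(** The geometric input of the mass distribution argument: a set of diameter [delta] meets boundedly
    many cylinders stopped at that scale, for every way of choosing children. *)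
Definition bounded_stops (v : seq L) := forall ch : seq (seq L) -> seq (seq L),
  (forall p, valid_path ch p -> uniq (ch p)) ->
  (forall p b, valid_path ch p -> b \in ch p -> size b = l) ->
  (forall p b b', valid_path ch p -> b \in ch p -> b' \in ch p -> b != b' -> Sep b b') ->
  exists N, forall (F : set 'rV[R]_d) delta, 0 < delta -> bounded_by F delta ->
    forall ps, uniq ps ->
    (forall p, p \in ps -> [/\ valid_path ch p,
       stops (fun p => kappa * rw (v ++ flatten p)) delta p &
       cylK (v ++ flatten p) `&` F !=set0]) ->
    (size ps <= N)%N.

Variables (Om : Type) (W : seq L -> Om -> {set L}) (om : Om) (v : seq L).
Local Notation T := (W^~ om).
Hypotheses (vT : intree T v) (goodv : forall k, good k (shift v T)).
Hypothesis stops_v : bounded_stops v.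

Let node (p : seq (seq L)) := v ++ flatten p.
Let ctr p := phiw (node p) x0.
Let rad p := D * rw (node p).

Let node_rcons p b : node (rcons p b) = node p ++ b.
Proof. by rewrite /node flatten_rcons catA. Qed.

Let rad_gt0 p : 0 < rad p. Proof. by rewrite mulr_gt0// (rw_gt0 simIFS). Qed.

Section Strategy.
Variables (beta : R) (sigma : alice_strategy R d).
Hypotheses (beta0 : 0 < beta) (beta_eta : beta * D <= eta).
Hypothesis beta_r : forall b, size b = l -> beta <= rw b.
Hypothesis sigma_legal : legal_strategy beta sigma.

Let ball_hist (p : seq (seq L)) : hist R d :=
  mkseq (fun k => (ctr (take k p), rad (take k p))) (size p).+1.

Let choices p (bs : seq (seq L)) := [/\ uniq bs,
  forall b, b \in bs -> [/\ size b = l, intree (shift (node p) T) b,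
    forall k, good k (shift (node p ++ b) T) &
    far_from (sigma (ball_hist p)).1.1 (sigma (ball_hist p)).1.2
      (ctr (rcons p b)) (rad (rcons p b)) (sigma (ball_hist p)).2],
  forall b b', b \in bs -> b' \in bs -> b != b' -> Sep b b' &
  1 <= \sum_(b <- bs) rw b `^ s].

(** The hyperplane is pulled back to the root scale, where goodness offers margin [eta]. Alice's
    thickness is below [beta * rad p], hence below [eta * rw (node p)], so the margin covers it. *)
Let choices_exist p : (forall k, good k (shift (node p) T)) -> exists bs, choices p bs.
Proof.
move=> gp.
have [a0 [_ epslt]] : (sigma (ball_hist p)).1.1 != 0 /\ 0 < (sigma (ball_hist p)).2 /\
    (sigma (ball_hist p)).2 < beta * rad p.
  have pos k : (k < size (ball_hist p))%N -> 0 < (nth (0, 0) (ball_hist p) k).2.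
    by rewrite size_mkseq => kp; rewrite nth_mkseq//; exact: rad_gt0.
  have <- : (last (0, 0) (ball_hist p)).2 = rad p.
    by rewrite -nth_last size_mkseq nth_mkseq//= take_size.
  have := @sigma_legal (ball_hist p) isT pos.
  by case: (sigma (ball_hist p)) => -[].
have [a' [c' [a0' E]]] := similarity_hyperplane (sigma (ball_hist p)).1.2
  (rw_gt0 simIFS (node p)) (phiw_sim simIFS (node p)) a0.
have [bs [ubs H1 H2 H3]] := good_limit gp c' a0'.
exists bs; split=> // b bbs; have [sb [tb gb] fb] := H1 b bbs; split=> //.
  by move=> k; rewrite shift_cat.
move=> z y zb /=.
have [z' z'E] := phiw_surj simIFS (node p) z; have [y' y'E] := phiw_surj simIFS (node p) y.
rewrite -z'E -y'E => /E hy'; rewrite (phiw_sim simIFS).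
apply: (@le_trans _ _ (rw (node p) * eta)).
  apply: (le_trans (ltW epslt)); rewrite /rad mulrCA mulrA mulrC ler_pM2l ?(rw_gt0 simIFS)//.
  by rewrite mulrC.
rewrite ler_pM2l ?(rw_gt0 simIFS)//; apply: fb hy'.
move: zb; rewrite /ctr /rad node_rcons phiw_cat -z'E (phiw_sim simIFS) rw_cat.
by rewrite mulrCA ler_pM2l ?(rw_gt0 simIFS).
Qed.

Let ch p : seq (seq L) := xget [::] (choices p).

Let good_valid p : valid_path ch p -> intree T (node p) /\ forall k, good k (shift (node p) T).
Proof.
elim/last_ind: p => [|p b IH]; first by rewrite /node cats0.
move=> /valid_rcons[/IH [tp gp] bp].
have [_ H _ _] := xgetPex [::] (choices_exist gp).
by have [_ tb gb _] := H b bp; rewrite node_rcons intree_cat tp tb.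
Qed.

Let ch_choices p : valid_path ch p -> choices p (ch p).
Proof. by move=> /good_valid[_ gp]; exact: xgetPex (choices_exist gp). Qed.

Let play_legal f : (forall n, valid_path ch (mkseq f n)) ->
  legal_play beta sigma (fun n => ctr (mkseq f n)) (fun n => rad (mkseq f n)).
Proof.
move=> fv; split=> // n.
have -> : play_hist (fun n => ctr (mkseq f n)) (fun n => rad (mkseq f n)) n = ball_hist (mkseq f n).
  rewrite /play_hist /ball_hist size_mkseq; apply/eq_in_map => k; rewrite mem_iota add0n => /andP[_].
  rewrite ltnS => kn; suff -> : take k (mkseq f n) = mkseq f k by [].
  by rewrite /mkseq -map_take take_iota (minn_idPl kn).
have [_ H _ _] := ch_choices (fv n).
have fn : f n \in ch (mkseq f n) by have := fv n.+1; rewrite mkseqS => /valid_rcons[].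
have [sb tb gb fb] := H _ fn; move: fb.
case: (sigma (ball_hist (mkseq f n))) => -[a c] eps /= fb.
rewrite mkseqS; split.
  by rewrite /rad node_rcons rw_cat mulrCA ler_pM2l// mulrC ler_pM2l ?(rw_gt0 simIFS)// beta_r.
move=> z /= zb; split.
  by move: zb; rewrite /cball /= /ctr /rad node_rcons; exact: ball_nested.
by move=> -[y hy]; rewrite ltNge fb.
Qed.

Let node_size p : valid_path ch p -> size (node p) = (size v + size p * l)%N.
Proof.
elim/last_ind: p => [|p b IH]; first by rewrite /node cats0 addn0.
move=> /valid_rcons[vp bp]; have [_ H _ _] := ch_choices vp.
have [sb _ _ _] := H b bp.
by rewrite node_rcons size_cat IH// sb size_rcons mulSn -addnA (addnC l).
Qed.

Let limit_in_fractal f x : (forall n, valid_path ch (mkseq f n)) ->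
  (forall n, cball (ctr (mkseq f n)) (rad (mkseq f n)) x) ->
  GW_fractal phi K W om x /\ forall n, cylK (node (mkseq f n)) x.
Proof.
move=> fv fx; pose w n := node (mkseq f n).
have sw n : size (w n) = (size v + n * l)%N by rewrite node_size// size_mkseq.
have wS n m : exists u, w (n + m)%N = w n ++ u.
  elim: m => [|m [u IH]]; first by exists [::]; rewrite addn0 cats0.
  by exists (u ++ f (n + m)%N); rewrite addnS /w mkseqS node_rcons -/(w _) IH catA.
have cyl n : cylK (w n) x.
  have /choice[u Hu] m := wS n m.
  apply: (@cylK_limit _ _ _ _ r _ simIFS attK x0 (w n) u x Kx0) => e e0.
  have eD : 0 < e / D by rewrite divr_gt0.
  have [m Hm] := rw_small simIFS eD.
  exists m; rewrite -Hu; apply: le_trans (fx (n + m)%N) _.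
  rewrite -ler_pdivlMl// mulrC; apply: Hm; rewrite sw mulnDl.
  by rewrite addnA; apply: leq_trans (leq_addl _ _); rewrite leq_pmulr.
split=> //.
have w1 m : (m < size (w m.+1))%N by rewrite sw mulSn; case: l l0 => // l' _; lia.
have i0 : L by case: (w 1%N) (w1 0%N).
(* The node after [m.+1] blocks has more than [m] letters since [l > 0], and later nodes extend
   it. *)
pose j m := nth i0 (w m.+1) m.
have jE n : mkseq j n = take n (w n).
  apply: (@eq_from_nth _ i0) => [|m]; rewrite size_mkseq.
    by rewrite size_takel// sw; apply: leq_trans (leq_addl _ _); rewrite leq_pmulr.
  move=> mn; rewrite nth_mkseq// nth_take// /j.
  by have [u] := wS m.+1 (n - m.+1)%N; rewrite subnKC// => ->; rewrite nth_cat w1.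
exists j; split=> n.
  apply/in_treeP; rewrite jE; have [+ _] := good_valid (fv n).
  by rewrite -/(w n) -{1}(cat_take_drop n (w n)) intree_cat => /andP[].
by rewrite jE; apply: cylK_take (cyl n).
Qed.

(** The children of a node are Bob's answers to Alice's move there, so each infinite path is a legal
    play and ends in [S]. For [t < s] the block sums of [rw b ^ t] remain at least 1, so the
    [t]-dimensional measure cannot vanish. *)
Lemma strategy_dimension (S : set 'rV[R]_d) :
  (forall c rho, legal_play beta sigma c rho -> (\bigcap_n cball (c n) (rho n)) `&` S !=set0) ->
  (s%:E <= hdim (GW_fractal phi K W om `&` S))%E.
Proof.
move=> Swin; apply: le_ereal_inf_tmp => _ [t [t0 Ht] <-].
rewrite lee_fin leNgt; apply/negP => ts; move: Ht.
have chv p : valid_path ch p -> choices p (ch p) by exact: ch_choices.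
apply: (@hausdorff_measure_neq0 R d _ ch (fun p => kappa * rw (v ++ flatten p))
   (fun p => cylK (v ++ flatten p))) => //.
- by move=> p; rewrite mulr_gt0// (rw_gt0 simIFS).
- by move=> p /chv[].
- move=> f fv delta de0; have dk : 0 < delta / kappa by rewrite divr_gt0.
  have [n Hn] := rw_small simIFS dk.
  exists n; rewrite -ler_pdivlMl// mulrC; apply: Hn.
  by rewrite -/(node _) node_size// size_mkseq; apply: leq_trans (leq_addl _ _); rewrite leq_pmulr.
- move=> p /chv[_ _ _ H1].
  rewrite (eq_bigr (fun b => (kappa * rw (v ++ flatten p)) `^ t * rw b `^ t)); last first.
    move=> b _; rewrite flatten_rcons catA rw_cat mulrA powRM//.
      by rewrite mulr_ge0 ?(ltW kappa0)// ltW// (rw_gt0 simIFS).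
    by rewrite ltW// (rw_gt0 simIFS).
  rewrite -mulr_sumr ler_peMr ?powR_ge0//; apply: (le_trans H1).
  apply: ler_sum => b _; apply: ger_powR; last exact: ltW.
  by rewrite (rw_gt0 simIFS) (rw_le1 simIFS).
- move=> f fv; have [x [xB Sx]] := Swin _ _ (play_legal fv).
  have [Ex cx] := @limit_in_fractal f x fv (fun n => xB n I).
  by exists x.
- apply: stops_v => [p /chv[]//|p b /chv[_ H _ _] /H[]//|p b b' /chv[_ _ H _]].
  exact: H.
Qed.

End Strategy.

Lemma HAW_dimension (S : set 'rV[R]_d) : HAW S ->
  (s%:E <= hdim (GW_fractal phi K W om `&` S))%E.
Proof.
move=> HS; have [rmin [rmax [rmin0 _ rmin1 rr]]] := ratio_bounds simIFS.
(* The three bounds make [beta] admissible, keep Alice's neighbourhood inside the margin [eta], and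
   make a descent by one block a legal choice of radius. *)
pose beta := Num.min 4^-1 (Num.min (eta / D) (rmin ^+ l)).
have b0 : 0 < beta by rewrite !lt_min invr_gt0 divr_gt0 ?exprn_gt0//= ltr0n.
have b4 : beta <= 4^-1 by rewrite ge_min lexx.
have bD : beta <= eta / D by rewrite ge_min ge_min lexx orbT.
have br : beta <= rmin ^+ l by rewrite ge_min ge_min lexx !orbT.
have [|sigma [sl sw]] := HS beta b0; first by lra.
apply: (@strategy_dimension beta sigma) => //.
  by rewrite -ler_pdivlMr.
move=> b bl; apply: (le_trans br); rewrite -bl; apply: rw_ge => [|i]; first exact: ltW.
by case/andP: (rr i).
Qed.

End Game.

(** * Counting stopped cylinders *)

Lemma seq_split (T : eqType) (p q : seq T) : p != q ->
  [\/ exists b s, q = p ++ b :: s, exists b s, p = q ++ b :: s |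
    exists u b b' p' q', [/\ p = u ++ b :: p', q = u ++ b' :: q' & b != b']].
Proof.
elim: p q => [|x p IH] [|y q] //.
- by move=> _; constructor 1; exists y, q.
- by move=> _; constructor 2; exists x, p.
have [->|xy] := eqVneq x y; last first.
  by move=> _; constructor 3; exists [::], x, y, p, q.
rewrite eqseq_cons eqxx /= => /IH[[b [s ->]]|[b [s ->]]|[u [b [b' [p' [q' [-> -> bb]]]]]]].
- by constructor 1; exists b, s.
- by constructor 2; exists b, s.
- by constructor 3; exists (y :: u), b, b', p', q'.
Qed.

(** Stopped nodes form an antichain, since a proper ancestor of one is still larger than [delta]; so
    is the node where two of them branch. *)
Lemma stops_split (R : realType) (B : choiceType) (rho : seq B -> R) delta p q :
  (forall u w, rho (u ++ w) <= rho u) -> stops rho delta p -> stops rho delta q -> p != q ->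
  exists u b b' p' q', [/\ p = u ++ b :: p', q = u ++ b' :: q', b != b' & delta < rho u].
Proof.
move=> mono; have above u b s : stops rho delta (u ++ b :: s) -> delta < rho u.
  move=> [_ H]; apply: lt_le_trans (mono u (belast b s)).
  by apply: (H _ (last b s)); rewrite rcons_cat -lastI.
move=> Hp Hq /seq_split[[b [s qE]]|[b [s pE]]|[u [b [b' [p' [q' [pE qE bb]]]]]]].
- by rewrite qE in Hq; have := above _ _ _ Hq; rewrite ltNge Hp.1.
- by rewrite pE in Hp; have := above _ _ _ Hp; rewrite ltNge Hq.1.
exists u, b, b', p', q'; split=> //.
by apply: (above u b p'); rewrite -pE.
Qed.

Section StopCounting.
Variables (R : realType) (d : nat) (L : finType).
Variables (phi : L -> 'rV[R]_d -> 'rV[R]_d) (r : L -> R) (K : set 'rV[R]_d).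
Hypotheses (simIFS : similarity_IFS phi r) (attK : is_attractor phi K).
Local Notation phiw := (phiw phi).
Local Notation rw := (rw r).
Local Notation cylK := (cylK phi K).

Let rw_mono u w : rw (u ++ w) <= rw u.
Proof. by rewrite rw_cat ler_piMr ?(rw_le1 simIFS)// ltW// (rw_gt0 simIFS). Qed.

(** Two stopped cylinders branch at a node [u] with [kappa * rw (v ++ flatten u) > delta], and
    separation puts them at least this far apart: [F] meets at most one. *)
Lemma bounded_stops_separated l (kappa : R) (Sep : seq L -> seq L -> Prop) v :
  0 < kappa ->
  (forall b b', Sep b b' -> forall x y, cylK b x -> cylK b' y -> kappa <= enorm (x - y)) ->
  bounded_stops phi r K l kappa Sep v.
Proof.
move=> kappa0 HS ch chu chl chS; exists 1%N => F delta de0 Fde ps ups Hps.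
rewrite leqNgt; apply/negP => sps.
case: ps ups Hps sps => [|p [|q ps]] //= /andP[pq _] Hps _.
have {pq} pq : p != q by apply: contra pq => /eqP ->; rewrite mem_head.
have [vp sp [x [px Fx]]] := Hps p (mem_head _ _).
have [vq sq [y [qy Fy]]] : [/\ valid_path ch q, stops (fun p => kappa * rw (v ++ flatten p)) delta q &
    cylK (v ++ flatten q) `&` F !=set0] by apply: Hps; rewrite !inE eqxx orbT.
have [|u [b [b' [p' [q' [pE qE bb du]]]]]] := stops_split _ sp sq pq.
  by move=> u w /=; rewrite flatten_cat catA ler_pM2l// rw_mono.
have Hsep : Sep b b'.
  apply: (chS u) => //; [|exact: vp pE|exact: vq qE].
  by move=> u' c w uE; apply: (vp u' c (w ++ b :: p')); rewrite pE uE -catA.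
move: px qy; rewrite pE qE !flatten_cat /= !catA => /(cylK_cat attK) px /(cylK_cat attK) qy.
case: px => kx Kkx xE; case: qy => ky Kky yE.
have : enorm (x - y) <= delta by exact: Fde.
rewrite -xE -yE (phiw_cat _ (v ++ flatten u) b) (phiw_cat _ (v ++ flatten u) b') (phiw_sim simIFS).
have : kappa <= enorm (phiw b kx - phiw b' ky).
  by apply: HS Hsep _ _ _ _; [exists kx|exists ky].
move=> /(ler_wpM2l (ltW (rw_gt0 simIFS (v ++ flatten u)))) h1 h2.
by move: du; rewrite ltNge mulrC (le_trans h1 h2).
Qed.

Section OpenSetCondition.
Variable U : set 'rV[R]_d.
Hypotheses (Uopen : open U) (phiU : forall i, phi i @` U `<=` U).
Hypothesis Udisj : forall i j, i != j -> phi i @` U `&` phi j @` U = set0.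

Let phiwU w : phiw w @` U `<=` U.
Proof.
elim: w => [|i w IH] _ [x Ux <-] //=; apply: phiU; exists (phiw w x) => //.
by apply: IH; exists x.
Qed.

Let phiw_disjoint b b' x y : size b = size b' -> b != b' -> U x -> U y ->
  phiw b x != phiw b' y.
Proof.
elim: b b' => [|i b IH] [|j b'] //= [sb].
have [->|ij] := eqVneq i j.
  rewrite eqseq_cons eqxx /= => /(IH _ sb) {}IH Ux Uy.
  apply: contra (IH Ux Uy) => /eqP e; rewrite -subr_eq0 -enorm_eq0.
  have := (simIFS j).2 (phiw b x) (phiw b' y); rewrite e subrr enorm0 => /esym/eqP.
  by rewrite mulf_eq0 => /orP[|//]; case: (simIFS j) => /andP[/gt_eqF ->].
move=> _ Ux Uy; apply/eqP => e.
have : (phi i @` U `&` phi j @` U) (phi i (phiw b x)).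
  split; first by exists (phiw b x) => //; apply: phiwU; exists x.
  by rewrite e; exists (phiw b' y) => //; apply: phiwU; exists y.
by rewrite Udisj.
Qed.

(** Were the two points closer, pulling the second back by [w ++ b ++ p] would give a point within
    [a] of [u0], hence in [U], and the images of [U] under [b] and [b'] would meet. *)
Lemma osc_separation u0 a w b b' p q : (forall y, enorm (u0 - y) < a -> U y) -> 0 < a ->
  size b = size b' -> b != b' ->
  a * rw (w ++ b ++ p) <= enorm (phiw (w ++ b ++ p) u0 - phiw (w ++ b' ++ q) u0).
Proof.
move=> Ua a0 sb bb; rewrite leNgt; apply/negP.
rewrite !(phiw_cat phi w) (phiw_sim simIFS) (rw_cat r w) mulrCA ltr_pM2l ?(rw_gt0 simIFS)//.
have [y yE] := phiw_surj simIFS (b ++ p) (phiw (b' ++ q) u0).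
rewrite -yE (phiw_sim simIFS) mulrC ltr_pM2r ?(rw_gt0 simIFS)// => /Ua Uy.
have U0 : U u0 by apply: Ua; rewrite subrr enorm0.
move: yE; rewrite !phiw_cat => /eqP; apply/negP/phiw_disjoint => //.
  by apply: phiwU; exists y.
by apply: phiwU; exists u0.
Qed.

(** The images of a point of [U] under stopped nodes are separated at scale [delta] and lie within a
    multiple of [delta] of any point of [F], so packing bounds their number. *)
Lemma bounded_stops_osc l v : U !=set0 ->
  bounded_stops phi r K l 1 (fun _ _ => True) v.
Proof.
move=> [u0 Uu0] ch chu chl _.
have [a a0 Ua] : exists2 a, 0 < a & forall y, enorm (u0 - y) < a -> U y.
  have /nbhs_ballP[a a0 aU] : nbhs u0 U by exact: open_nbhs_nbhs.
  exists a => // y yu; apply: aU; split=> // i j; rewrite (ord1 i).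
  by apply: le_lt_trans yu; have := coord_le_enorm (u0 - y) j; rewrite !mxE.
have [rmin [rmax [rmin0 _ _ rr]]] := ratio_bounds simIFS.
have [C0 C00 KC] : exists2 C : R, 0 < C & forall x, K x -> enorm x <= C.
  by apply: compact_enorm_bounded; case: attK => _ [].
pose tau := rmin ^+ l; have tau0 : 0 < tau by rewrite exprn_gt0.
pose C := enorm u0 + C0 + 1.
have C_ge0 : 0 <= C by rewrite !addr_ge0// ?enorm_ge0// ltW.
have [N HN] := @packing R d C (a * tau) (mulr_gt0 a0 tau0) C_ge0.
exists N => F delta de0 Fde ps ups Hps.
have [->//|[p0 p0ps]] : ps = [::] \/ exists p, p \in ps.
  by case: ps {ups Hps} => [|p ps]; [left|right; exists p; rewrite mem_head].
have [_ _ [z0 [_ Fz0]]] := Hps p0 p0ps.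
apply: (HN _ ps (fun p => phiw (v ++ flatten p) u0) z0 delta de0 ups).
  move=> p /Hps[_ [pde _] [x [[k Kk kx] Fx]]].
  apply: le_trans (enorm_triangle x _ _) _.
  have xz : enorm (x - z0) <= delta by exact: Fde.
  rewrite -[in X in X + _]kx (phiw_sim simIFS).
  have uk : enorm (u0 - k) <= enorm u0 + C0.
    by apply: le_trans (enormD _ _) _; rewrite enormN lerD2l KC.
  have : rw (v ++ flatten p) * enorm (u0 - k) <= delta * (enorm u0 + C0).
    by rewrite mul1r in pde; apply: ler_pM; rewrite ?enorm_ge0// ltW// (rw_gt0 simIFS).
  by rewrite /C; lra.
move=> p q pps qps pq; have [vp sp _] := Hps p pps; have [vq sq _] := Hps q qps.
have [|u [b [b' [p' [q' [pE qE bb du]]]]]] := stops_split _ sp sq pq.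
  by move=> u w /=; rewrite flatten_cat catA !mul1r rw_mono.
have vu : valid_path ch u.
  by move=> u' c w uE; apply: (vp u' c (w ++ b :: p')); rewrite pE uE -catA.
have sb : size b = l by apply: (chl u) => //; exact: vp pE.
have sb' : size b' = l by apply: (chl u) => //; exact: vq qE.
(* The parent of [p] is larger than [delta], and one block shrinks by a factor no smaller than
   [tau]. *)
have tp : tau * delta <= rw (v ++ flatten p).
  case/lastP: p {pps pq} pE vp sp => [|w c] pE vp sp; first by case: u pE {qE vu du}.
  have /valid_rcons[vw cw] := vp.
  have := sp.2 w c erefl; rewrite mul1r => dw.
  rewrite flatten_rcons catA rw_cat mulrC; apply: ler_pM; [exact: ltW|exact: ltW|exact: ltW|].
  rewrite /tau -(chl w c vw cw); apply: rw_ge => [|i]; first exact: ltW.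
  by case/andP: (rr i).
rewrite -mulrA; apply: le_trans (ler_wpM2l (ltW a0) tp) _.
rewrite pE qE !flatten_cat /= !(catA v).
by apply: osc_separation => //; rewrite sb sb'.
Qed.

End OpenSetCondition.

End StopCounting.

(** * Probability of a good subtree *)

Section Levels.
Variable L : finType.

Fixpoint level n : seq (seq L) :=
  if n is n'.+1 then [seq i :: w | i <- enum L, w <- level n'] else [:: [::]].

Lemma mem_level n w : (w \in level n) = (size w == n).
Proof.
elim: n w => [|n IH] [|i w] //=; first by apply/allpairsP => -[[j u] []].
rewrite eqSS -IH; apply/allpairsP/idP => [[[j u] [_ ju [_ ->]]]//|iw].
by exists (i, w); rewrite mem_enum.
Qed.

Lemma uniq_level n : uniq (level n).
Proof.
elim: n => //= n IH; apply: allpairs_uniq; rewrite ?enum_uniq//.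
by move=> -[i w] [j u] _ _ /= [-> ->].
Qed.

Lemma wsum_level (R : realType) (w : L -> R) (H : lab L -> R) n (t : lab L) :
  wsum w H n t = \sum_(u <- level n | intree t u) (\prod_(i <- u) w i) * H (shift u t).
Proof.
elim: n t => [|n IH] t; first by rewrite /= big_mkcond big_seq1 /= big_nil mul1r.
rewrite [RHS]big_mkcond /= big_allpairs_dep big_enum /=.
rewrite big_mkcond /=; apply: eq_bigr => i _; case: ifP => it.
  rewrite IH mulr_sumr -[RHS]big_mkcond /=; apply: eq_bigr => u _.
  by rewrite big_cons mulrA -shift_cat.
by rewrite big1.
Qed.

Lemma agree_wsum (R : realType) (w : L -> R) k n (t t' : lab L) : agree n t t' ->
  wsum w (fun=> k) n t = wsum w (fun=> k) n t'.
Proof.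
elim: n t t' => //= n IH t t' a; rewrite a//; apply: eq_bigr => i _.
by congr (_ * _); apply: IH; exact: (@agree_shift _ _ [:: i]).
Qed.

Lemma intree_rcons (t : lab L) w i : intree t (rcons w i) = intree t w && (i \in t w).
Proof. by rewrite -cats1 intree_cat /= andbT /shift cats0. Qed.

End Levels.

(** Supplies the exponent for two blocks of ratio at least [x]. *)
Lemma exists_half_power (R : realType) (x : R) : 0 < x <= 1 ->
  exists2 s, 0 < s & 1 <= 2 * x `^ s.
Proof.
move=> /andP[x0 x1]; have two1 : 1 < 2 :> R by rewrite ltr1n.
have [n Hn] := expr_unbounded x^-1 two1.
have n1 : 0 < n.+1%:R :> R by rewrite ltr0n.
exists (n.+1%:R^-1); first by rewrite invr_gt0.
have h2 : 0 <= (2^-1 : R) by lra.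
have xn : 2^-1 ^+ n.+1 <= x.
  rewrite exprVn invf_ple ?posrE ?exprn_gt0//; apply: (le_trans Hn).
  by rewrite exprS ler_peMl ?exprn_ge0//; lra.
have : (2^-1 ^+ n.+1) `^ (n.+1%:R^-1) <= x `^ (n.+1%:R^-1).
  by apply: ge0_ler_powR => //; rewrite ?invr_ge0 ?nnegrE ?exprn_ge0// ltW.
rewrite -powR_mulrn// -powRrM mulfV ?gt_eqF// powRr1//; lra.
Qed.

Lemma enorm_separation (R : realType) d (x x' y y' : 'rV[R]_d) e :
  enorm (x - y) <= e / 4 -> enorm (x' - y') <= e / 4 -> e <= enorm (y' - y) ->
  e / 2 <= enorm (x - x').
Proof.
have := enorm_triangle x' y' y; have := enorm_triangle x x' y.
rewrite (enormC y' x') (enormC x' x); lra.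
Qed.

Section GoodProbability.
Variables (R : realType) (d : nat) (L : finType).
Variables (phi : L -> 'rV[R]_d -> 'rV[R]_d) (r : L -> R) (K : set 'rV[R]_d).
Hypotheses (simIFS : similarity_IFS phi r) (attK : is_attractor phi K).
Hypotheses (d0 : (0 < d)%N) (Kspan : forall a c, a != 0 -> ~ K `<=` hyperplane a c).
Variable p : {set L} -> R.
Hypotheses (p_ge0 : forall s, 0 <= p s) (p_sum1 : \sum_s p s = 1).
Hypothesis supercritical : 1 < \sum_s p s * #|s|%:R.
Hypothesis p_mem : forall i, exists2 s : {set L}, i \in s & 0 < p s.
Variables (x0 : 'rV[R]_d) (D : R).
Hypotheses (Kx0 : K x0) (D0 : 0 < D) (KD : forall x, K x -> enorm (x - x0) <= D).
Hypothesis HD : forall b, enorm (phiw phi b x0 - x0) <= D - rw r b * D.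
Local Notation phiw := (phiw phi).
Local Notation rw := (rw r).
Local Notation cylK := (cylK phi K).

(* The tree has a spine [i^k] along which both [i] and [j] are kept; the branch
   leaving it through [i^k j] follows the coding of the [k]-th point. *)
Lemma spanning_tree : exists (t0 : lab L) (y : nat -> 'rV[R]_d) (eta : R),
  [/\ forall u, 0 < p (t0 u), 0 < eta,
    forall k n, exists w, [/\ size w = n, intree t0 w & cylK w (y k)] &
    forall a c, a != 0 -> exists2 k, (k <= d)%N & eta * enorm a <= `|edot a (y k) - c| ].
Proof.
have [s2 ps2 /card_gt1P[i [j [i_s j_s ij]]]] := branching_set p_ge0 p_sum1 supercritical.
have /choice[sel Hsel] k : exists s : {set L}, k \in s /\ 0 < p s.
  by have [s ks ps] := p_mem k; exists s.
pose u k := rcons (nseq k i) j.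
have [y [eta [yA eta0 Hy]]] := spanning_points d0
  (fun k => cylK_off_hyperplane simIFS (u k) Kspan).
have /choice[x Hx] k : exists x : nat -> L, forall n, cylK (u k ++ mkseq x n) (y k).
  have [z Kz zy] := yA k; have [x Hx] := coding attK Kz.
  exists x => n; have [z' Kz' zz'] := Hx n.
  by exists z' => //; rewrite phiw_cat zz'.
pose t0 (w : seq L) := let k := find (predC1 i) w in
  if k == size w then s2 else sel (x k (size w - k.+1)%N).
have t0_spine k : t0 (nseq k i) = s2.
  by rewrite /t0 hasNfind ?eqxx// has_nseq /= eqxx andbF.
have t0_branch k n : t0 (u k ++ mkseq (x k) n) = sel (x k n).
  rewrite /t0 /u cat_rcons find_cat has_nseq /= eqxx andbF (eq_sym j i) ij addn0 size_nseq.
  rewrite size_cat size_nseq /= size_mkseq -[X in X == _]addn0 eqn_add2l /=.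
  by rewrite addnS subSS addKn.
have tree k n : intree t0 (u k ++ mkseq (x k) n).
  elim: n => [|n IH].
    rewrite cats0 intree_rcons t0_spine j_s andbT.
    elim: k => // k IH; rewrite -[k.+1]addn1 nseqD cats1 intree_rcons IH.
    by rewrite t0_spine.
  by rewrite mkseqS -rcons_cat intree_rcons IH t0_branch; case: (Hsel (x k n)).
exists t0, y, eta; split=> //.
  by move=> w; rewrite /t0; case: ifP => // _; case: (Hsel (x (find (predC1 i) w) (size w - (find (predC1 i) w).+1)%N)).
move=> k n; exists (take n (u k ++ mkseq (x k) n)); split.
- by rewrite size_takel// size_cat size_mkseq leq_addl.
- by have := tree k n; rewrite -{1}(cat_take_drop n (u k ++ _)) intree_cat => /andP[].
- exact: cylK_take (Hx k n).
Qed.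

Lemma cylK_near w y z : cylK w y -> enorm (z - phiw w x0) <= D * rw w ->
  enorm (z - y) <= 2 * (D * rw w).
Proof.
move=> [k Kk <-] Hz; apply: le_trans (enorm_triangle (phiw w x0) _ _) _.
rewrite (phiw_sim simIFS w x0 k) (enormC x0 k).
have := ler_wpM2l (ltW (rw_gt0 simIFS w)) (KD Kk); lra.
Qed.

(** The point [y] is at distance at least [eta] from the hyperplane, and the ball of any extension
    of [w] stays within [eta / 2] of [y]. *)
Lemma far_block a c w u y eta : a != 0 -> cylK w y ->
  eta * enorm a <= `|edot a y - c| -> 4 * (D * rw w) <= eta ->
  far_from a c (phiw (w ++ u) x0) (D * rw (w ++ u)) (eta / 2).
Proof.
move=> a0 wy Hy weta z y' zb hy'.
have zy := cylK_near wy (ball_nested simIFS HD zb).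
have an : 0 < enorm a by rewrite enorm_gt0.
have : eta <= enorm (y - y').
  by rewrite -(ler_pM2l an) mulrC; apply: le_trans Hy _; exact: hyperplane_dist.
have := enorm_triangle z y y'; rewrite (enormC y z); lra.
Qed.

Lemma good_Pr (G : nat -> set (lab L)) l q : G 0%N = setT -> q <= 1 ->
  (forall k, q <= Pr p (k * l) (G k) -> q <= Pr p (k.+1 * l) (G k.+1)) ->
  forall k, q <= Pr p (k * l) (G k).
Proof.
move=> G0 q1 GS; elim=> [|k IH]; last exact: GS.
rewrite G0 /Pr (@eq_Ex _ _ _ _ _ (fun=> 1)) ?Ex_cst// => t.
by rewrite /ind asboolT.
Qed.

(** A block is [w0 ++ u ++ w] with [w] one of two branches: [w0] in the covering tree avoids the
    hyperplane, [u] is some vertex whose subtree contains the covering tree again with good ends,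
    and [w1], [w2] end near two distinct points. With unit weights and threshold 1, one such [u]
    suffices. *)
Lemma good_probability_separated : exists (l : nat) (eta s kappa q : R),
  [/\ (0 < l)%N, 0 < eta, 0 < s, 0 < kappa & 0 < q] /\ forall k, q <= Pr p (k * l)
    (good phi r x0 D l eta s
      (fun b b' => forall x y, cylK b x -> cylK b' y -> kappa <= enorm (x - y)) k).
Proof.
have [t0 [y [eta [pt0 eta0 ycode yspan]]]] := spanning_tree.
have [kd ykd] : exists k, y k != y 0%N.
  have a1 : (const_mx 1 : 'rV[R]_d) != 0.
    by apply/eqP => /rowP/(_ (Ordinal d0)); rewrite !mxE; apply/eqP; rewrite oner_eq0.
  have [k _ Hk] := yspan _ (edot (const_mx 1) (y 0%N)) a1; exists k.
  apply: contraTneq Hk => ->; rewrite subrr normr0 -ltNge mulr_gt0// enorm_gt0//.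
pose dy := enorm (y kd - y 0%N).
have dy0 : 0 < dy by rewrite enorm_gt0 subr_eq0.
have [rmin [rmax [rmin0 _ rmin1 rr]]] := ratio_bounds simIFS.
(* The first bound is the hypothesis of [far_block]; the second keeps the cylinders of [w1] and [w2]
   within [dy / 4] of [y 0] and [y kd]. *)
pose e1 := Num.min (eta / (4 * D)) (dy / (8 * D)).
have e10 : 0 < e1 by rewrite lt_min !divr_gt0// mulr_gt0.
have [n0 Hn0] := rw_small simIFS e10.
have small w : size w = n0.+1 -> 4 * (D * rw w) <= eta /\ 2 * (D * rw w) <= dy / 4.
  move=> wn; have := Hn0 w; rewrite wn => /(_ (leqnSn _)); rewrite le_min => /andP[].
  by rewrite !ler_pdivlMr ?mulr_gt0// => h1 h2; split; lra.
have w01 (i : L) : 0 <= (1 : R) <= 1 by rewrite ler01 lexx.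
have m1 : 1 < meanw p (fun=> 1).
  rewrite /meanw (_ : \sum_s _ = \sum_s p s * #|s|%:R)//.
  by apply: eq_bigr => s _; rewrite sumr_const.
have [c c0 Hc] := rich_descendants p_ge0 p_sum1 w01 m1.
have [q1 q10 Hq1] := Pr_covers p_ge0 p_sum1 n0.+1 pt0 c0.
(* Capped at 1 because goodness of depth 0 has probability exactly 1. *)
pose q := Num.min q1 1.
have q0 : 0 < q by rewrite lt_min q10 ltr01.
have [h h0 Hh] := Pr_covers p_ge0 p_sum1 n0.+1 pt0 q0.
have [n Hn] := Hc h 1 h0.
pose l := (n0.+1 + (n + n0.+1))%N.
have x01 : 0 < rmin ^+ l <= 1 by rewrite exprn_gt0// exprn_ile1// ltW.
have [s s0 Hs] := exists_half_power x01.
(* The common part [w0 ++ u] of the two blocks contracts by at least this power of [rmin], and the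
   ends are [dy / 2] apart. *)
pose kappa := rmin ^+ (n0.+1 + n) * (dy / 2).
exists l, (eta / 2), s, kappa, q; split.
  split=> //; first by rewrite divr_gt0.
  by rewrite mulr_gt0 ?exprn_gt0// divr_gt0.
set Sep := fun b b' => _.
apply: good_Pr => //; first by rewrite ge_min lexx orbT.
move=> k Hk; have -> : (k.+1 * l = n0.+1 + (n + (n0.+1 + k * l)))%N by rewrite mulSn /l !addnA.
apply: (@le_trans _ _ q1); first by rewrite ge_min lexx.
apply: le_trans (Hq1 _ _ (Hn _ _ (Hh _ _ Hk))) _.
apply: Pr_le => // t Ht a cc a0.
have [ka _ Hka] := yspan a cc a0; have [w0 [sw0 tw0 cw0]] := ycode ka n0.+1.
have [tw0' /= Hsum] := Ht w0 sw0 tw0; have [small1 _] := small w0 sw0.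
have [u [su tu Hu]] : exists u, [/\ size u = n, intree (shift w0 t) u &
    covers n0.+1 t0 (good phi r x0 D l (eta / 2) s Sep k) (shift (w0 ++ u) t)].
  apply: contrapT => H; move: Hsum; apply/negP; rewrite -ltNge wsum_level.
  rewrite big_seq_cond big1 ?ltr01// => u /andP[]; rewrite mem_level => /eqP su tu.
  rewrite /ind asboolF ?mulr0// => Hu; apply: H; exists u; split=> //.
  by rewrite shift_cat.
have [w1 [sw1 tw1 cw1]] := ycode 0%N n0.+1; have [w2 [sw2 tw2 cw2]] := ycode kd n0.+1.
have sep12 x z : cylK w1 x -> cylK w2 z -> dy / 2 <= enorm (x - z).
  move=> c1 c2; have [_ s1] := small w1 sw1; have [_ s2] := small w2 sw2.
  have ball w x' : cylK w x' -> enorm (x' - phiw w x0) <= D * rw w.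
    by move=> [k' Kk <-]; rewrite (phiw_sim simIFS) mulrC ler_pM2r ?(rw_gt0 simIFS)// KD.
  apply: (@enorm_separation _ _ x z (y 0%N) (y kd)) => //.
    by have h1 := cylK_near cw1 (ball _ _ c1); exact: le_trans h1 s1.
  by have h2 := cylK_near cw2 (ball _ _ c2); exact: le_trans h2 s2.
have base_ge : rmin ^+ (n0.+1 + n) <= rw (w0 ++ u).
  rewrite -sw0 -su -size_cat; apply: rw_ge => [|i]; first exact: ltW.
  by case/andP: (rr i).
have sepb b b' x z : (forall x z, cylK b x -> cylK b' z -> dy / 2 <= enorm (x - z)) ->
    cylK (w0 ++ u ++ b) x -> cylK (w0 ++ u ++ b') z -> kappa <= enorm (x - z).
  move=> Hb [kx Kx <-] [kz Kz <-]; rewrite !catA (phiw_cat _ _ b) (phiw_cat _ _ b').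
  rewrite (phiw_sim simIFS) /kappa; apply: ler_pM; rewrite ?exprn_ge0 ?divr_ge0//; try exact: ltW.
  by apply: Hb; [exists kx|exists kz].
have sw w : size w = n0.+1 -> size (w0 ++ u ++ w) = l by move=> sw; rewrite !size_cat sw0 su sw.
exists [:: w0 ++ u ++ w1; w0 ++ u ++ w2]; split.
- rewrite /= inE andbT !catA eqseq_cat// eqxx /=; apply/eqP => w12.
  have := sep12 (y 0%N) (y 0%N) cw1; rewrite -w12 subrr enorm0 => /(_ cw1).
  by rewrite leNgt divr_gt0.
- move=> b; rewrite !inE => /orP[]/eqP ->; split.
  + exact: sw.
  + have [t1 g1] := Hu w1 sw1 tw1; rewrite /= catA -shift_cat in t1 g1 *.
    by split; [rewrite intree_cat intree_cat tw0' tu|].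
  + exact: far_block Hka small1.
  + exact: sw.
  + have [t1 g1] := Hu w2 sw2 tw2; rewrite /= catA -shift_cat in t1 g1 *.
    by split; [rewrite intree_cat intree_cat tw0' tu|].
  + exact: far_block Hka small1.
- move=> b b'; rewrite !inE => /orP[]/eqP -> /orP[]/eqP ->; rewrite ?eqxx// => _ x z.
    by apply: sepb.
  apply: sepb => x' z' c2 c1; rewrite enormC; exact: sep12.
- rewrite big_cons big_seq1; apply: (le_trans Hs).
  have rwl w : size w = n0.+1 -> (rmin ^+ l) `^ s <= rw (w0 ++ u ++ w) `^ s.
    move=> wn; apply: ge0_ler_powR; rewrite ?nnegrE ?(ltW s0)//.
    - by rewrite exprn_ge0// ltW.
    - by rewrite ltW// (rw_gt0 simIFS).
    - rewrite -(sw w wn); apply: rw_ge => [|i]; first exact: ltW.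
      by case/andP: (rr i).
  by rewrite mulr_natl mulr2n; apply: lerD; exact: rwl.
Qed.

Lemma rw_powR (s : R) w : \prod_(i <- w) r i `^ s = rw w `^ s.
Proof.
elim: w => [|i w IH]; first by rewrite big_nil rw_nil powR1.
rewrite big_cons rw_cons IH powRM// ltW ?(rw_gt0 simIFS)//.
by case: (simIFS i) => /andP[].
Qed.

(** All good blocks [w0 ++ u] are used. The threshold for the weight below [w0] is the inverse of
    the least possible weight of [w0], which brings the total to 1; it may be large, since
    [rich_descendants] fixes its probability before the threshold. *)
Lemma good_probability_rich s : 0 <= s -> 1 < meanw p (fun i => r i `^ s) ->
  exists (l : nat) (eta q : R), [/\ (0 < l)%N, 0 < eta, 0 < q &
    forall k, q <= Pr p (k * l) (good phi r x0 D l eta s (fun _ _ => True) k)].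
Proof.
move=> s0 m1.
have [t0 [y [eta [pt0 eta0 ycode yspan]]]] := spanning_tree.
have [rmin [rmax [rmin0 _ rmin1 rr]]] := ratio_bounds simIFS.
have e10 : 0 < eta / (4 * D) by rewrite divr_gt0// mulr_gt0.
have [n0 Hn0] := rw_small simIFS e10.
have small w : size w = n0.+1 -> 4 * (D * rw w) <= eta.
  move=> wn; have := Hn0 w; rewrite wn => /(_ (leqnSn _)).
  by rewrite ler_pdivlMr ?mulr_gt0//; lra.
have w01 (i : L) : 0 <= r i `^ s <= 1.
  have /andP[ri0 ri1] := (simIFS i).1.
  by rewrite powR_ge0 -(powRr0 (r i)) ger_powR// ri0 ltW.
have [c c0 Hc] := rich_descendants p_ge0 p_sum1 w01 m1.
have [q1 q10 Hq1] := Pr_covers p_ge0 p_sum1 n0.+1 pt0 c0.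
pose q := Num.min q1 1.
have q0 : 0 < q by rewrite lt_min q10 ltr01.
have X0 : 0 < (rmin ^+ n0.+1) `^ s by rewrite powR_gt0// exprn_gt0.
have [n Hn] := Hc q ((rmin ^+ n0.+1) `^ s)^-1 q0.
pose l := (n0.+1 + n)%N.
exists l, (eta / 2), q; split=> //; first by rewrite divr_gt0.
apply: good_Pr => //; first by rewrite ge_min lexx orbT.
move=> k Hk; have -> : (k.+1 * l = n0.+1 + (n + k * l))%N by rewrite mulSn /l !addnA.
apply: (@le_trans _ _ q1); first by rewrite ge_min lexx.
apply: le_trans (Hq1 _ _ (Hn _ _ Hk)) _.
apply: Pr_le => // t Ht a cc a0.
have [ka _ Hka] := yspan a cc a0; have [w0 [sw0 tw0 cw0]] := ycode ka n0.+1.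
have [tw0' /= Hsum] := Ht w0 sw0 tw0; have small1 := small w0 sw0.
pose G := good phi r x0 D l (eta / 2) s (fun _ _ => True) k.
pose us := [seq u <- level L n | intree (shift w0 t) u && `[< G (shift (w0 ++ u) t) >]].
exists [seq w0 ++ u | u <- us]; split=> //.
- rewrite map_inj_uniq ?filter_uniq ?uniq_level// => u u' /eqP.
  by rewrite eqseq_cat// eqxx => /eqP.
- move=> b /mapP[u]; rewrite mem_filter mem_level => /andP[/andP[tu /asboolP Gu] /eqP su] ->.
  split; [by rewrite size_cat sw0 su| |exact: far_block Hka small1].
  by split=> //; rewrite /= intree_cat tw0' tu.
- rewrite big_map big_filter.
  have -> : \sum_(u <- level L n | intree (shift w0 t) u && `[< G (shift (w0 ++ u) t) >]) rw (w0 ++ u) `^ s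
      = rw w0 `^ s * wsum (fun i => r i `^ s) (ind R G) n (shift w0 t).
    rewrite wsum_level mulr_sumr big_mkcondr /=; apply: eq_bigr => u tu.
    rewrite rw_powR -shift_cat /ind rw_cat powRM; try by rewrite ltW// (rw_gt0 simIFS).
    by case: asboolP => _; rewrite ?mulr1 ?mulr0.
  apply: (@le_trans _ _ ((rmin ^+ n0.+1) `^ s * ((rmin ^+ n0.+1) `^ s)^-1)).
    by rewrite mulfV// gt_eqF.
  apply: ler_pM; rewrite ?powR_ge0 ?invr_ge0 ?powR_ge0//.
  apply: ge0_ler_powR; rewrite ?nnegrE//.
  + by rewrite exprn_ge0// ltW.
  + by rewrite ltW// (rw_gt0 simIFS).
  + rewrite -sw0; apply: rw_ge => [|i]; first exact: ltW.
    by case/andP: (rr i).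
Qed.

End GoodProbability.

(** * The theorem *)

Section Dimension.
Variables (R : realType) (d : nat).
Implicit Types A B S : set 'rV[R]_d.

Lemma hausdorff_delta_ge0 (s delta : R) A : (0 <= hausdorff_delta s delta A)%E.
Proof.
apply: le_ereal_inf_tmp => _ [F _ <-].
by apply: nneseries_ge0 => n _ _; exact: hterm_ge0.
Qed.

Lemma hausdorff_measure_ge0 (s : R) A : (0 <= hausdorff_measure s A)%E.
Proof.
apply: le_trans (hausdorff_delta_ge0 s 1 A) _.
by apply: ereal_sup_ubound; exists 1 => //=.
Qed.

Lemma hausdorff_measure_le (s : R) A B : A `<=` B ->
  (hausdorff_measure s A <= hausdorff_measure s B)%E.
Proof.
move=> AB; apply: ge_ereal_sup => _ [delta d0 <-].
apply: (@le_trans _ _ (hausdorff_delta s delta B)).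
  apply: ereal_inf_le_tmp => _ [F [BF bF] <-]; exists F => //.
  by split=> //; exact: subset_trans BF.
by apply: ereal_sup_ubound; exists delta.
Qed.

Lemma hdim_le A B : A `<=` B -> (hdim A <= hdim B)%E.
Proof.
move=> AB; apply: ereal_inf_le_tmp => _ [s [s0 Hs] <-]; exists s => //; split=> //.
by apply/le_anti; rewrite hausdorff_measure_ge0 andbT -Hs hausdorff_measure_le.
Qed.

Lemma hdim_ge0 A : (0 <= hdim A)%E.
Proof. by apply: le_ereal_inf_tmp => _ [s [s0 _] <-]; rewrite lee_fin. Qed.

(** Alice must name a nonzero normal vector, and there is none in dimension 0. *)
Lemma HAW_dim_gt0 S : HAW S -> (0 < d)%N.
Proof.
move=> /(_ 4^-1) []; [by lra|by lra|] => sigma [legal _].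
have := legal [:: (0, 1)] isT; case: (sigma _) => -[a c] eps /=.
have -> : (forall k, (k < 1)%N -> 0 < (nth (0, 0) [:: (0 : 'rV[R]_d, 1 : R)] k).2) = True.
  by rewrite propeqE; split=> // _ [|//] _ /=; exact: ltr01.
case=> // a0 _; case: d a a0 {legal sigma} => // a.
by rewrite thinmx0 eqxx.
Qed.

End Dimension.

(** * Upper bound by level covers *)

Section UpperBound.
Variables (R : realType) (d : nat) (L : finType).
Variables (phi : L -> 'rV[R]_d -> 'rV[R]_d) (r : L -> R) (K : set 'rV[R]_d).
Hypotheses (simIFS : similarity_IFS phi r) (attK : is_attractor phi K).
Variables (x0 : 'rV[R]_d) (D : R).
Hypotheses (D0 : 0 < D) (KD : forall x, K x -> enorm (x - x0) <= D).
Local Notation rw := (rw r).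
Local Notation cylK := (cylK phi K).

Let cyl_bounded w : bounded_by (cylK w) (2 * D * rw w).
Proof.
move=> _ _ [x Kx <-] [y Ky <-]; rewrite (phiw_sim simIFS) mulrC ler_pM2r ?(rw_gt0 simIFS)//.
apply: le_trans (enorm_triangle x0 _ _) _; rewrite (enormC x0 y).
by have := KD Kx; have := KD Ky; lra.
Qed.

Lemma hterm_le (s delta : R) (F : set 'rV[R]_d) : 0 <= s -> 0 <= delta -> bounded_by F delta ->
  (hterm s F <= (delta `^ s)%:E)%E.
Proof.
move=> s0 de0 Fd; rewrite /hterm; case: pselect => Fn; first by rewrite lee_fin powR_ge0.
have [x Fx] : F !=set0 by apply/set0P/eqP.
have ub : ubound [set enorm (x - y) | x in F & y in F] delta.
  by move=> _ [y Fy [z Fz <-]]; exact: Fd.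
rewrite lee_fin; apply: ge0_ler_powR; rewrite ?nnegrE//.
  apply: le_trans (ub_le_sup _ _); [exact: (enorm_ge0 (x - x))|by exists delta|].
  by exists x => //; exists x.
by apply: ge_sup => //; exists (enorm (x - x)), x => //; exists x.
Qed.

(** The surviving cylinders of one deep level cover the fractal, at a cost that is a constant
    multiple of the weighted level sum. *)
Lemma hdim_fractal_le (Om : Type) (W : seq L -> Om -> {set L}) om s : 0 <= s ->
  (forall e N, 0 < e -> exists2 n, (N <= n)%N &
     wsum (fun i => r i `^ s) (fun=> 1) n (W^~ om) <= e) ->
  (hdim (GW_fractal phi K W om) <= s%:E)%E.
Proof.
move=> s0 small; apply: ereal_inf_lbound; exists s => //; split=> //.
apply/le_anti; rewrite hausdorff_measure_ge0 andbT.
apply: ge_ereal_sup => _ [delta /= de0 <-]; apply/lee_addgt0Pr => e e0; rewrite add0e.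
have D20 : 0 < 2 * D by rewrite mulr_gt0.
have [N HN] := rw_small simIFS (divr_gt0 de0 D20).
have e0' : 0 < e / (2 * D) `^ s by rewrite divr_gt0// powR_gt0.
have [n Nn Hn] := small _ N e0'.
pose ws := [seq u <- level L n | intree (W^~ om) u].
pose F k : set 'rV[R]_d := if (k < size ws)%N then cylK (nth [::] ws k) else set0.
have size_ws w : w \in ws -> size w = n.
  by rewrite mem_filter mem_level => /andP[_ /eqP].
apply: (@le_trans _ _ (\sum_(0 <= k <oo) hterm s (F k))%E).
  apply: ereal_inf_lbound; exists F => //; split.
    move=> x [j [jb jx]]; exists (index (mkseq j n) ws) => //.
    have jws : mkseq j n \in ws.
      rewrite mem_filter mem_level size_mkseq eqxx andbT; exact/in_treeP/jb.
    by rewrite /F index_mem jws nth_index//; exact: jx.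
  move=> k; rewrite /F; case: ifP => [kw|_]; last by move=> x y [].
  move=> x y Fx Fy; apply: le_trans (cyl_bounded Fx Fy) _.
  by rewrite mulrC -ler_pdivlMr// HN// (size_ws _ (mem_nth _ kw)).
rewrite (@nneseries_split _ _ 0%N (size ws)) => [|k _]; last exact: hterm_ge0.
rewrite add0n [X in (_ + X)%E]eseries0 => [|k wk _]; last first.
  by rewrite /F ltnNge wk /hterm; case: pselect.
rewrite adde0; apply: (@le_trans _ _ (\sum_(0 <= k < size ws) ((2 * D * rw (nth [::] ws k)) `^ s)%:E)%E).
  rewrite big_nat [leRHS]big_nat; apply: lee_sum => k kw.
  rewrite /F; move: kw => /= ->; apply: hterm_le => //.
  by rewrite mulr_ge0 ?(ltW D20)// ltW// (rw_gt0 simIFS).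
rewrite sumEFin lee_fin -(big_nth [::] xpredT (fun w => (2 * D * rw w) `^ s)).
rewrite (eq_bigr (fun w => (2 * D) `^ s * rw w `^ s)) => [|w _]; last first.
  by rewrite powRM ?(ltW D20)// ltW// (rw_gt0 simIFS).
rewrite -mulr_sumr mulrC -ler_pdivlMr ?powR_gt0//; apply: le_trans Hn.
rewrite wsum_level big_filter le_eqVlt; apply/orP; left; apply/eqP/eq_bigr => w _.
by rewrite mulr1 (rw_powR simIFS).
Qed.

End UpperBound.

Section MeanWeight.
Variables (R : realType) (d : nat) (L : finType).
Variables (phi : L -> 'rV[R]_d -> 'rV[R]_d) (r : L -> R).
Hypothesis simIFS : similarity_IFS phi r.
Variable p : {set L} -> R.
Hypothesis p_ge0 : forall s, 0 <= p s.
Let mean s := meanw p (fun i => r i `^ s).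

Lemma mean_powR0 : mean 0 = \sum_s p s * #|s|%:R.
Proof.
apply: eq_bigr => s _; congr (_ * _).
by under eq_bigr do rewrite powRr0; rewrite sumr_const.
Qed.

Lemma mean_ge0 s : 0 <= mean s.
Proof.
by apply: sumr_ge0 => A _; rewrite mulr_ge0// sumr_ge0// => i _; rewrite powR_ge0.
Qed.

(** Replaces continuity of [mean] and the solution of [mean s = 1]: the critical exponent will enter
    only as a supremum. *)
Lemma mean_decay : exists2 q : R, 0 < q < 1 &
  forall s e, 0 <= e -> mean (s + e) <= q `^ e * mean s.
Proof.
have [rmin [q [_ q01 _ rq]]] := ratio_bounds simIFS; exists q => // s e e0.
rewrite /mean /meanw mulr_sumr; apply: ler_sum => A _; rewrite mulrCA ler_wpM2l//.
rewrite mulr_sumr; apply: ler_sum => i _; have /andP[ri0 _] := (simIFS i).1.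
rewrite powRD; last by rewrite (gt_eqF ri0) implybT.
rewrite mulrC ler_wpM2r ?powR_ge0//; apply: ge0_ler_powR; rewrite ?nnegrE//.
- exact: ltW.
- by case/andP: q01 => /ltW.
- by case/andP: (rq i).
Qed.

Lemma mean_le s t : s <= t -> mean t <= mean s.
Proof.
move=> st; have [q /andP[q0 q1] Hq] := mean_decay.
have ts : 0 <= t - s by rewrite subr_ge0.
have := Hq s _ ts; rewrite addrC subrK => /le_trans; apply.
by rewrite ler_piMl ?mean_ge0// -(powRr0 q) ger_powR// q0 ltW.
Qed.

Lemma mean_lt1 s t : s < t -> mean s <= 1 -> mean t < 1.
Proof.
move=> st s1; have [q /andP[q0 q1] Hq] := mean_decay.
have ts : 0 <= t - s by rewrite subr_ge0 ltW.
have := Hq s _ ts; rewrite addrC subrK => /le_lt_trans; apply.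
have qe : q `^ (t - s) < 1.
  rewrite -[ltRHS](_ : 1 `^ (t - s) = 1); last by rewrite powR1.
  apply: gt0_ltr_powR; rewrite ?subr_gt0 ?nnegrE//.
  exact: ltW.
by apply: le_lt_trans qe; rewrite ler_piMr ?powR_ge0.
Qed.

Lemma mean_eventually_le1 : exists s, mean s <= 1.
Proof.
have [q /andP[q0 q1] Hq] := mean_decay.
have qV : 1 < q^-1 by rewrite invf_gt1.
have [n Hn] := expr_unbounded (mean 0) qV.
exists n%:R; have := Hq 0 _ (ler0n R n); rewrite add0r powR_mulrn ?(ltW q0)// => /le_trans; apply.
by rewrite mulrC -ler_pdivlMr ?exprn_gt0// mul1r -exprVn.
Qed.

End MeanWeight.

Theorem theorem1p6
  (R : realType) (d : nat) (L : finType)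
  (phi : L -> 'rV[R]_d -> 'rV[R]_d) (r : L -> R)
  (K : set 'rV[R]_d)
  (d0 : measure_display) (Om : measurableType d0) (P : probability Om R)
  (W : seq L -> Om -> {set L}) :
  similarity_IFS phi r ->
  is_attractor phi K ->
  iid_offspring P W ->
  (* P(i \in W) > 0 for every i *)
  (forall i : L, (0 < P [set om | i \in W [::] om])%E) ->
  (* E|W| > 1 *)
  (1 < \sum_(s : {set L}) P [set om | W [::] om = s] * (#|s|%:R)%:E)%E ->
  (* E is non-planar: no affine hyperplane contains E almost surely *)
  ~ (exists (a : 'rV[R]_d) (c : R), a != 0 /\
       {ae P, forall om, GW_fractal phi K W om `<=` hyperplane a c}) ->
  {ae P, forall om, nonextinct W om ->
     exists C : R, 0 < C /\
       forall S : set 'rV[R]_d, HAW S ->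
         (C%:E < hdim (GW_fractal phi K W om `&` S))%E}
  /\
  (open_set_condition phi ->
   {ae P, forall om, nonextinct W om ->
     forall S : set 'rV[R]_d, HAW S ->
       hdim (GW_fractal phi K W om `&` S) = hdim (GW_fractal phi K W om)}).
Proof.
move=> simIFS attK iidW Wpos Wmean nonplanar.
case: (posnP d) => [de0|d_gt0].
  have noHAW S : ~ @HAW R d S by move=> /HAW_dim_gt0; rewrite de0.
  split=> [|_]; apply: aeW => om _; first by exists 1; split=> // S /noHAW.
  by move=> S /noHAW.
pose p := offspring P W.
have p_ge0 : forall s, 0 <= p s by exact: offspring_ge0.
have p_sum1 : \sum_s p s = 1 by exact: offspring_sum1.
have supercritical : 1 < \sum_s p s * #|s|%:R.
  move: Wmean; under eq_bigr do rewrite (offspringE iidW) -EFinM.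
  by rewrite sumEFin lte_fin.
have Kspan (a : 'rV[R]_d) c : a != 0 -> ~ K `<=` hyperplane a c.
  move=> a0 Ka; apply: nonplanar; exists a, c; split=> //; apply: aeW => om.
  by apply: subset_trans Ka; exact: GW_fractal_sub.
have p_mem i : exists2 s : {set L}, i \in s & 0 < p s.
  apply: contrapT => H; have := Wpos i.
  suff -> : P [set om | i \in W [::] om] = 0%E by rewrite ltxx.
  have [|_ ->] := @event_law _ _ _ _ P W iidW 1%N [set t : lab L | i \in t [::]].
    by move=> t t' a /=; rewrite a.
  congr (_%:E); rewrite /Pr ExS big1// => s _; have [is_|is_] := boolP (i \in s).
    have -> : offspring P W s = 0; last by rewrite mul0r.
    apply/eqP; rewrite eq_le p_ge0 andbT leNgt; apply/negP => ps.
    by apply: H; exists s.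
  rewrite /Exr big1 ?mulr0// => f _; rewrite /ind asboolF ?mulr0//=.
  exact/negP.
have [x0 [D [Kx0 D0 KD HD]]] := bounding_ball simIFS attK.
have reaches l eta s Sep q : 0 < q ->
    (forall k, q <= Pr p (k * l) (good phi r x0 D l eta s Sep k)) ->
    {ae P, forall om, nonextinct W om -> exists2 v, intree (W^~ om) v &
      forall k, good phi r x0 D l eta s Sep k (shift v (W^~ om))}.
  move=> q0 Hq; apply: (survival_reaches iidW supercritical q0).
    by move=> k; exact: good_dec.
  by move=> k; exists (k * l)%N; [exact: good_depends|exact: Hq].
split.
  have [l [eta [s [kappa [q [[l0 eta0 s0 kappa0 q0] Hq]]]]]] :=
    good_probability_separated simIFS attK d_gt0 Kspan p_ge0 p_sum1 supercritical p_mem D0 KD HD.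
  apply: filterS (reaches _ _ _ _ _ q0 Hq) => om Hom ne; have [v vT gv] := Hom ne.
  (* Half of [s] turns the bound by [s] into a strict inequality. *)
  exists (s / 2); split; first by rewrite divr_gt0.
  move=> S HS; apply: (@lt_le_trans _ _ s%:E).
    by rewrite lte_fin ltr_pdivrMr// ltr_pMr// ltrDl.
  apply: (HAW_dimension simIFS attK Kx0 D0 HD l0 eta0 (ltW s0) kappa0 vT gv) => //.
  by apply: bounded_stops_separated.
move=> [U [Uo [U0 [phiU Udisj]]]].
pose mean s := meanw p (fun i => r i `^ s).
have lower s : 0 <= s -> 1 < mean s -> {ae P, forall om, nonextinct W om ->
    forall S, HAW S -> (s%:E <= hdim (GW_fractal phi K W om `&` S))%E}.
  move=> s0 ms; have [l [eta [q [l0 eta0 q0 Hq]]]] :=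
    good_probability_rich simIFS attK d_gt0 Kspan p_ge0 p_sum1 supercritical p_mem D0 KD HD s0 ms.
  apply: filterS (reaches _ _ _ _ _ q0 Hq) => om Hom ne S HS; have [v vT gv] := Hom ne.
  apply: (HAW_dimension simIFS attK Kx0 D0 HD l0 eta0 s0 ltr01 vT gv) => //.
  exact: (bounded_stops_osc simIFS attK Uo phiU Udisj).
have upper s : 0 <= s -> mean s < 1 ->
    {ae P, forall om, (hdim (GW_fractal phi K W om) <= s%:E)%E}.
  move=> s0 ms.
  suff H : {ae P, forall om, forall k N : nat, exists2 n, (N <= n)%N &
      wsum (fun i => r i `^ s) (fun=> 1) n (W^~ om) <= k.+1%:R^-1}.
    apply: filterS H => om Hom; apply: (hdim_fractal_le simIFS D0 KD s0) => e N e0.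
    have [n Nn Hn] := Hom (Num.truncn e^-1) N; exists n => //; apply: (le_trans Hn).
    by rewrite invf_ple ?posrE//; exact/ltW/truncnS_gt.
  (* Markov's inequality: the mean of the level sum is [mean s ^+ n], so one large [n] makes the
     exceptional event small. *)
  apply/ae_foralln => k; apply/ae_foralln => N; apply: ae_not_small => e e0.
  have m0 : 0 <= mean s by exact: mean_ge0.
  have [n [Nn Hn]] : exists n, (N <= n)%N /\ k.+1%:R * mean s ^+ n <= e.
    have [->|mn0] := eqVneq (mean s) 0.
      by exists N.+1; rewrite leqnSn expr0n mulr0; split=> //; exact: ltW.
    have mV : 1 < (mean s)^-1 by rewrite invf_gt1// lt_def mn0.
    have [n Hn] := expr_unbounded (k.+1%:R / e) mV.
    exists (N + n)%N; rewrite leq_addr; split=> //.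
    apply: (@le_trans _ _ (k.+1%:R * mean s ^+ n)).
      rewrite ler_wpM2l//; apply: ler_wiXn2l (leq_addl _ _) => //; exact: ltW.
    move: Hn; rewrite exprVn ler_pdivrMr// mulrC -ler_pdivrMr ?invr_gt0 ?exprn_gt0 ?lt_def ?mn0//.
    by rewrite invrK.
  pose Y := wsum (fun i => r i `^ s) (fun=> 1) n.
  have [|mA PA] := @event_law _ _ _ _ P W iidW n [set t | k.+1%:R^-1 < Y t].
    by move=> t t' a /=; rewrite /Y (agree_wsum _ _ a).
  exists [set om | k.+1%:R^-1 < Y (W^~ om)]; split=> //.
    move=> om H; rewrite /= ltNge; apply/negP => Hle; apply: H.
    by exists n.
  rewrite PA lee_fin; apply: le_trans Hn.
  have <- : Ex p (n + 0) Y = mean s ^+ n.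
    by rewrite /Y (Ex_wsum p_sum1) (Ex_cst p_sum1) mulr1.
  rewrite addn0 -ExZ; apply: Ex_le => // t; rewrite /ind.
  have Y0 : 0 <= Y t.
    rewrite /Y wsum_level; apply: sumr_ge0 => u _; rewrite mulr1 prodr_ge0// => i _.
    exact: powR_ge0.
  case: asboolP => [/= h|_]; last by rewrite mulr_ge0.
  by rewrite mulrC -ler_pdivrMr// mul1r ltW.
pose A := [set s : R | 0 <= s /\ 1 < mean s].
have A0 : A 0 by split=> //; rewrite /mean mean_powR0.
have hA : has_sup A.
  split; first by exists 0.
  have [s Hs] := mean_eventually_le1 simIFS p_ge0; exists s => t [_ mt].
  rewrite leNgt; apply/negP => st; move: mt; apply/negP; rewrite -leNgt.
  by apply: le_trans Hs; apply: (mean_le simIFS p_ge0); exact: ltW.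
pose delta := sup A.
have de0 : 0 <= delta by apply: ub_le_sup A0; case: hA.
(* Exponents approach [delta] along a sequence, so that countably many null sets are discarded. *)
have HL : {ae P, forall om, forall n : nat, nonextinct W om ->
    forall S, HAW S -> ((delta - n.+1%:R^-1)%:E <= hdim (GW_fractal phi K W om `&` S))%E}.
  apply/ae_foralln => n; have n0 : 0 < n.+1%:R^-1 :> R by rewrite invr_gt0.
  have [s0|s0] := ltP (delta - n.+1%:R^-1) 0.
    by apply: aeW => om _ S _; apply: le_trans (hdim_ge0 _); rewrite lee_fin ltW.
  apply: lower => //; have [t [t0 mt] st] := sup_adherent n0 hA.
  by apply: lt_le_trans mt _; apply: (mean_le simIFS p_ge0); exact: ltW.
have HU : {ae P, forall om, forall n : nat,
    (hdim (GW_fractal phi K W om) <= (delta + n.+1%:R^-1)%:E)%E}.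
  apply/ae_foralln => n; have n0 : 0 < n.+1%:R^-1 :> R by rewrite invr_gt0.
  apply: upper; first by rewrite addr_ge0// ltW.
  (* At the midpoint [mean] is at most 1, as the midpoint exceeds [sup A]; strict decrease then
     gives [mean < 1] at the endpoint. *)
  apply: (@mean_lt1 _ _ _ _ _ simIFS _ p_ge0 (delta + n.+1%:R^-1 / 2)).
    by rewrite ltrD2l ltr_pdivrMr// ltr_pMr// ltrDl.
  rewrite leNgt; apply/negP => mt.
  have : delta + n.+1%:R^-1 / 2 <= delta.
    apply: ub_le_sup; first by case: hA.
    by split=> //; rewrite addr_ge0// ltW// divr_gt0.
  by rewrite gerDl leNgt divr_gt0.
apply: filterS2 HL HU => om HL HU ne S HS.
apply/le_anti/andP; split; first by apply: hdim_le; exact: subIsetl.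
have small (e : R) : 0 < e -> exists n : nat, n.+1%:R^-1 <= e.
  by move=> e0; exists (Num.truncn e^-1); rewrite invf_ple ?posrE//; exact/ltW/truncnS_gt.
apply: (@le_trans _ _ delta%:E).
  apply/lee_addgt0Pr => e e0; have [n Hn] := small e e0.
  by apply: le_trans (HU n) _; rewrite -EFinD lee_fin lerD2l.
apply/lee_addgt0Pr => e e0; have [n Hn] := small e e0.
apply: le_trans (leeD2r e%:E (HL n ne S HS)).
by rewrite -EFinD lee_fin -addrA lerDl addrC subr_ge0.
Qed.
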